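(* Suppose that $v(a)\ge v(c)/\ell$. In the tame case, if $v(c)<0$, then $K_\infty=K_1$. In the wild case, for any integer $n\ge 1$: if $v(c)<\nu_n$, then $K_\infty=K_n$; and if $v(c)=\nu_n$, then $K_\infty=K_{n+1}$ and $K_{n+1}/K_n$ is unramified.
   Context: $K$ is a field complete with respect to a discrete valuation $v$, with residue field of characteristic $p$ (possibly $0$); $v$ is extended to an algebraic closure $\overline{K}$. $f(z)=z^\ell-c\in K[z]$ with $\ell\ge 2$ an integer and $c\in K^\times$, and one of the following cases holds: (tame case) $\ell$ is not divisible by $p$; (wild case) $\ell=p$ and $K$ is a finite extension of $\mathbb{Q}_p$, with $v$ normalized so that $v(p)=1$. In the wild case, $\nu_n=-\frac{p^{n+1}}{(p^n-1)(p-1)}$ for $n\ge1$. $f^n$ is the $n$-th iterate of $f$; $a\in K$ is such that for every $n\ge0$ the solutions of $f^n(z)=a$ in $\overline{K}$ are distinct; $f^{-n}(a)$ is the set of these solutions; $K_n=K(f^{-n}(a))$; $K_\infty=\bigcup_{n\ge1}K_n$. *)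

(* Defs.v *)
From HB Require Import structures.
From mathcomp Require Import all_boot all_order all_algebra.
From mathcomp Require Import generic_quotient ring_quotient.
From mathcomp Require Import mxpoly separable.
From mathcomp Require Import boolp classical_sets reals constructive_ereal.

Set Implicit Arguments.
Unset Strict Implicit.
Unset Printing Implicit Defensive.

Import Order.TTheory GRing.Theory Num.Theory.

Local Open Scope classical_set_scope.
Local Open Scope ring_scope.

(* Additive (rank one) valuations of a field, with values in R + {+oo}.
   They are not assumed to be nontrivial or discrete. *)
Record valuation (R : realType) (F : fieldType) := Valuation {
  val_fun :> F -> \bar R;
  val0 : val_fun 0 = +oo%E;
  val_fin_num : forall x, x != 0 -> val_fun x \is a fin_num;
  valM : {morph val_fun : x y / x * y >-> (x + y)%E};
  valD : forall x y, (Order.min (val_fun x) (val_fun y) <= val_fun (x + y)%R)%E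
}.

Section ResidueField.
Variables (R : realType) (F : fieldType) (v : valuation R F).

Lemma val_fineK x : x != 0 -> (fine (v x))%:E = v x.
Proof. by move=> x0; rewrite fineK // val_fin_num. Qed.

Lemma val1 : v 1 = 0%E.
Proof.
have := valM v 1 1; rewrite mulr1 -(val_fineK (oner_neq0 F)) -EFinD.
by move=> [] /eqP; rewrite -{1}[fine _]addr0 (inj_eq (addrI _)) => /eqP <-.
Qed.

Lemma val_eqy x : (v x == +oo%E) = (x == 0).
Proof.
have [->|x0] := eqVneq x 0; first by rewrite val0 eqxx.
by rewrite -(val_fineK x0).
Qed.

Lemma valN1 : v (-1) = 0%E.
Proof.
have N1 : -1 != 0 :> F by rewrite oppr_eq0 oner_neq0.
have := valM v (-1) (-1); rewrite mulrNN mulr1 val1 -(val_fineK N1) -EFinD.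
by move=> [] /esym /eqP; rewrite -mulr2n mulrn_eq0 /= => /eqP ->.
Qed.

Lemma valN x : v (- x) = v x.
Proof. by rewrite -mulN1r valM valN1 add0e. Qed.

Lemma valV x : x != 0 -> v x^-1 = (- v x)%E.
Proof.
move=> x0; have := valM v x x^-1; rewrite divff // val1.
rewrite -(val_fineK x0) -(@val_fineK x^-1) ?invr_eq0 // -EFinD -EFinN.
by move=> [] /esym /eqP; rewrite addrC addr_eq0 => /eqP ->.
Qed.

(* The valuation ring, as a predicate and then as a ring of its own. *)
Definition integral_pred : {pred F} := fun x => (0 <= v x)%E.

Lemma integral_subring : subring_closed integral_pred.
Proof.
split=> [|x y|x y]; rewrite !unfold_in.
- by rewrite val1.
- move=> x0 y0; apply: le_trans (valD v x (- y)).
  by rewrite valN le_min x0.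
- by move=> x0 y0; rewrite valM adde_ge0.
Qed.

HB.instance Definition _ :=
  GRing.isSubringClosed.Build F integral_pred integral_subring.

Record integers := Integer {
  integer_val :> F;
  integerP : integer_val \in integral_pred
}.

HB.instance Definition _ := [isSub for integer_val].
HB.instance Definition _ := [Choice of integers by <:].
HB.instance Definition _ :=
  [SubChoice_isSubComNzRing of integers by <:].

Definition maximal_ideal : {pred integers} := fun x => (0 < v (val x))%E.

Lemma maximal_zmod : zmod_closed maximal_ideal.
Proof.
split=> [|x y]; rewrite !unfold_in /=; first by rewrite val0 ltry.
move=> x0 y0; apply: lt_le_trans (valD v (val x) (- val y)).
by rewrite valN lt_min x0.
Qed.

Lemma maximal_proper : ring_quotient.proper_ideal maximal_ideal.
Proof.
split=> [|a x]; rewrite !unfold_in /=; first by rewrite val1 ltxx.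
by move=> x0; rewrite valM; apply: lt_le_trans x0 _; rewrite leeDr //; exact: integerP.
Qed.

HB.instance Definition _ :=
  GRing.isZmodClosed.Build integers maximal_ideal maximal_zmod.
HB.instance Definition _ :=
  isProperIdeal.Build integers maximal_ideal maximal_proper.

Definition residue_field := {ideal_quot maximal_ideal}.

HB.instance Definition _ := GRing.ComNzRing.on residue_field.

Definition residue (x : integers) : residue_field := (\pi_residue_field x)%qT.

HB.instance Definition _ :=
  GRing.RMorphism.copy residue (\pi_residue_field)%qT.

Lemma residue_eq0 (x : integers) : (residue x == 0) = (0 < v (val x))%E.
Proof.
by rewrite /residue -(rmorph0 (\pi_residue_field)%qT) -Quotient.idealrBE subr0.
Qed.

Definition residue_inv (t : residue_field) : residue_field :=
  residue (insubd 0 (val (repr t))^-1).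

Lemma residue_mulVf t : t != 0 -> residue_inv t * t = 1.
Proof.
rewrite -[t in t != 0]reprK -[t in _ * t]reprK -/(residue _) residue_eq0.
rewrite /residue_inv; case: (repr t) => x xi /=.
have x0 : (0 <= v x)%E by exact: xi.
rewrite lt_neqAle x0 andbT negbK eq_sym => /eqP vx0.
have xN0 : x != 0 by rewrite -(val_eqy) vx0.
rewrite /residue -rmorphM -(rmorph1 (\pi_residue_field)%qT).
congr (\pi_residue_field)%qT; apply: val_inj.
by rewrite rmorphM rmorph1 /= val_insubd unfold_in valV // vx0 oppe0 lexx mulVf.
Qed.

Lemma residue_inv0 : residue_inv 0 = 0.
Proof.
apply/eqP; rewrite residue_eq0 val_insubd unfold_in.
have : residue (repr (0 : residue_field)) == 0 by rewrite /residue reprK.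
rewrite residue_eq0; set x := val _ => x0.
have [->|xN0] := eqVneq x 0; first by rewrite invr0 val0 /= le0y /= val0 ltry.
by rewrite valV // oppe_ge0 leNgt x0 /= val0 ltry.
Qed.

HB.instance Definition _ :=
  GRing.ComNzRing_isField.Build residue_field residue_mulVf residue_inv0.

End ResidueField.

(* The prime p is the characteristic of k, or p = 0 and k has characteristic
   zero. *)
Definition has_characteristic (k : nzRingType) (p : nat) : Prop :=
  p \in [pchar k] \/ (p = 0%N /\ [pchar k] =i pred0).

Section Valued.
Variables (R : realType) (F : fieldType) (v : valuation R F).

(* The value group v(F^* ) is infinite cyclic. *)
Definition discrete_valuation : Prop :=
  exists2 d : R, 0 < d &
    v @` [set x | x != 0] = [set (d *~ m)%:E | m in [set: int]].

(* Every Cauchy sequence converges, for the absolute value attached to v. *)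
Definition complete_valuation : Prop :=
  forall u : nat -> F,
    (forall M : R, exists N : nat, forall m n : nat,
       (N <= m)%N -> (N <= n)%N -> (M%:E < v (u m - u n)%R)%E) ->
    exists x : F, forall M : R, exists N : nat, forall n : nat,
      (N <= n)%N -> (M%:E < v (u n - x)%R)%E.

(* The residue field of a subfield M of F, inside the one of F. *)
Definition residue_set (M : set F) : set (residue_field v) :=
  [set residue x | x in [set x : integers v | M (val x)]].

(* The extension L / M of subfields of F has ramification index 1 and a
   separable residue extension; for finite extensions of complete discretely
   valued fields this is the usual definition of "unramified". *)
Definition unramified (M L : set F) : Prop :=
  [/\ M `<=` L,
      v @` L = v @` M &
      forall t, residue_set L t ->
        exists P : {poly residue_field v},
          [/\ forall i, residue_set M P`_i, separable_poly P & root P t]].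

End Valued.

Definition padic_val (R : realType) (p : nat) (q : rat) : \bar R :=
  if q == 0 then +oo%E
  else ((logn p `|numq q|)%:R - (logn p `|denq q|)%:R)%:E.

(* (F, v) is the field Q_p: the completion of the rationals for the p-adic
   valuation. *)
Definition is_Qp (R : realType) (p : nat) (F : fieldType)
    (v : valuation R F) : Prop :=
  [/\ prime p,
      forall q : rat, v (ratr q) = padic_val R p q,
      complete_valuation v &
      forall (x : F) (M : R), exists q : rat, (M%:E < v (x - ratr q)%R)%E].

(* (K, v) is a finite extension of Q_p with its normalized valuation. *)
Definition finite_extension_of_Qp (R : realType) (p : nat) (K : fieldType)
    (v : valuation R K) : Prop :=
  exists (Q : fieldType) (vQ : valuation R Q) (j : {rmorphism Q -> K}),
    [/\ is_Qp p vQ,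
        forall x : Q, v (j x) = vQ x &
        exists (d : nat) (b : 'I_d -> K), forall x : K,
          exists t : 'I_d -> Q, x = \sum_(i < d) j (t i) * b i].

Definition iter_poly (F : fieldType) (f : {poly F}) (n : nat) : {poly F} :=
  iter n (fun g => f \Po g) 'X.

Section Preimages.
Variables (K Kbar : fieldType) (iota : {rmorphism K -> Kbar}).

(* The subfield K(S) of Kbar. *)
Definition adjoin (S : set Kbar) : set Kbar :=
  smallest [set A | GRing.divring_closed (mem A)] (range iota `|` S).

Variables (f : {poly K}) (a : K).

Definition preimages (n : nat) : set Kbar :=
  [set z | (map_poly iota (iter_poly f n)).[z] = iota a].

Definition preimage_field (n : nat) : set Kbar := adjoin (preimages n).

Definition preimage_field_infty : set Kbar :=
  \bigcup_(n in [set n | (1 <= n)%N]) preimage_field n.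

(* The solutions of f^n(z) = a, listed with multiplicity, are distinct. *)
Definition distinct_preimages (n : nat) : Prop :=
  exists2 s : seq Kbar, uniq s &
    let P := map_poly iota (iter_poly f n - a%:P) in
    P = lead_coef P *: \prod_(z <- s) ('X - z%:P).

End Preimages.

Definition nu (R : realType) (p n : nat) : R :=
  - (p%:R ^+ n.+1 / ((p%:R ^+ n - 1) * (p%:R - 1))).

(* Main.v *)
From HB Require Import structures.
Require Import Defs.
From mathcomp Require Import all_boot all_order all_algebra.
From mathcomp Require Import mxpoly separable lra zify.
From mathcomp Require Import boolp classical_sets reals constructive_ereal.
From Stdlib Require Import Ring Field.

(** Write C for - v c, and let x_0 = a, x_1, x_2, ... be a chain of preimages,
    x_(i+1)^l = x_i + c, so that x_m solves f^m(z) = a.  Since v a >= - C / l,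
    every x_i with i >= 1 has valuation - C / l, and
      (x_(m+1) / x_m)^l = (x_m + c) / (x_(m-1) + c) = 1 + d_m
    with d_m = (x_m - x_(m-1)) / (x_(m-1) + c) small.  All l-th roots of unity
    are quotients of elements of f^(-1)(a), hence lie in K_m for m >= 1, so
    x_(m+1) lies in K_m as soon as 1 + d_m is an l-th power there.  As K_m is
    complete (it is finite over K: [ex_adjunction_seq]), this holds when v d_m
    exceeds v l + (v l) / (l - 1) ([root_near_one]).

    In the tame case the bound is 0, while v d_m >= C - C / l > 0.

    In the wild case the bound is e = p / (p - 1).  An estimate for d_m gives
    one for x_(m+1) / x_m - 1 ([val_ge_of_exp]: p-th roots divide valuations
    by p, up to e), and so for d_(m+1); starting from v d_1 >= C - C / p this
    yields v d_m >= C (1 - p^(-m)) as long as that is at most e, and v d_m > e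
    afterwards ([val_ratio_wild]).  The number nu_n is the value of - C for
    which C (1 - p^(-n)) = e ([nu_mulE]).  So v c < nu_n gives v d_m > e for
    all m >= n, and v c = nu_n gives v d_n >= e, and v d_m > e for m > n.

    It remains to see that K_(n+1) / K_n is unramified when all v d_n >= e.
    Let z be a primitive p-th root of unity, P = z - 1, which has valuation
    1 / (p - 1), and write x_(n+1) / x_n = 1 + P t.  Then t is integral, and
    its residue satisfies an Artin-Schreier equation T^p - T = alpha over the
    residue field k_M of the field M reached so far.  Either this residue is in
    k_M, and then x_(n+1) is in M; or its powers of exponent less than p
    are independent over k_M ([artin_schreier_free]), and then the valuation of
    a combination of the t^i over M is the least valuation of a coefficient
    ([val_horner_free]).  In both cases M(x_(n+1)) has the value group of M
    ([val_kummer_step]).  Separability of the residue extension comes from K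
    being finite over Q_p: every residue is algebraic over F_p, so it is fixed
    by a power of Frobenius ([residue_periodic]). *)

Set Implicit Arguments.
Unset Strict Implicit.
Unset Printing Implicit Defensive.

Import Order.TTheory GRing.Theory Num.Theory.
Import Defs.

Local Open Scope classical_set_scope.
Local Open Scope ring_scope.

(** * Field identities *)

Section FieldTheory.
Variable F : fieldType.

(** The procedures [ring] and [field] read the carrier off the operations; these
    copies all have the carrier F itself, whatever path of structures the
    operations of a goal were inferred through. *)
Definition fzero : F := 0.
Definition fone : F := 1.
Definition fadd : F -> F -> F := +%R.
Definition fmul : F -> F -> F := *%R.
Definition fopp : F -> F := -%R.
Definition finv : F -> F := GRing.inv.

Lemma field_opsE : (0 = fzero) * (1 = fone)
  * (forall x y, x + y = fadd x y) * (forall x y, x * y = fmul x y)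
  * (forall x, - x = fopp x) * (forall x, x^-1 = finv x).
Proof. by []. Qed.

Lemma field_theory_F : @field_theory F fzero fone fadd fmul
  (fun x y => fadd x (fopp y)) fopp (fun x y => fmul x (finv y)) finv eq.
Proof.
split=> //; last by move=> x /eqP/mulVf.
  split=> //; [exact: add0r|exact: addrC|exact: addrA|exact: mul1r
    |exact: mulrC|exact: mulrA|exact: mulrDl|exact: subrr].
exact/eqP/oner_neq0.
Qed.

End FieldTheory.

Ltac fold_field_ops :=
  rewrite ?exprS ?expr0 ?mulr1 ?field_opsE;
  match goal with |- @eq _ ?a ?b => change (@eq (GRing.Field.sort _) a b) end.
Ltac ring_F := fold_field_ops; ring.
Ltac field_F :=
  fold_field_ops; field; rewrite ?/fzero ?/fone ?/fadd ?/fmul ?/fopp ?/finv.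

(** * Estimates for a valuation *)

Section Estimates.
Variables (R : realType) (F : fieldType) (w : valuation R F).
Implicit Types (x y : F) (r s : R).

Lemma val_ge_add (e : \bar R) x y :
  (e <= w x)%E -> (e <= w y)%E -> (e <= w (x + y)%R)%E.
Proof. by move=> ex ey; apply: le_trans (valD w x y); rewrite le_min ex. Qed.

Lemma val_gt_add (e : \bar R) x y :
  (e < w x)%E -> (e < w y)%E -> (e < w (x + y)%R)%E.
Proof. by move=> ex ey; apply: lt_le_trans (valD w x y); rewrite lt_min ex. Qed.

Lemma val_ge_sub (e : \bar R) x y :
  (e <= w x)%E -> (e <= w y)%E -> (e <= w (x - y)%R)%E.
Proof. by move=> ex ey; rewrite val_ge_add ?valN. Qed.

Lemma val_gt_sub (e : \bar R) x y :
  (e < w x)%E -> (e < w y)%E -> (e < w (x - y)%R)%E.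
Proof. by move=> ex ey; rewrite val_gt_add ?valN. Qed.

Lemma val_ge_sum (I : Type) (t : seq I) (P : pred I) (G : I -> F) (e : \bar R) :
  (forall i, P i -> e <= w (G i))%E -> (e <= w (\sum_(i <- t | P i) G i)%R)%E.
Proof.
move=> Ge; elim/big_ind : _ => //; first by rewrite val0 leey.
exact: val_ge_add.
Qed.

Lemma val_ge_mul r s x y :
  (r%:E <= w x)%E -> (s%:E <= w y)%E -> ((r + s)%R%:E <= w (x * y)%R)%E.
Proof. by move=> rx sy; rewrite valM EFinD leeD. Qed.

Lemma val_gt_mul r s x y :
  (r%:E < w x)%E -> (s%:E <= w y)%E -> ((r + s)%R%:E < w (x * y)%R)%E.
Proof.
move=> rx sy; rewrite valM EFinD.
case: (w x) (w y) rx sy => [a||] [b||] //=; rewrite ?ltry //.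
rewrite lte_fin lee_fin -!EFinD lte_fin; exact: ltr_leD.
Qed.

Lemma val_eq_mul r s x y :
  w x = r%:E -> w y = s%:E -> w (x * y) = (r + s)%:E.
Proof. by rewrite valM => -> ->. Qed.

Lemma val_neq0 r x : w x = r%:E -> x != 0.
Proof. by rewrite -(val_eqy w) => ->. Qed.

Lemma val_eq_inv r x : w x = r%:E -> w x^-1 = (- r)%:E.
Proof. by move=> xr; rewrite valV ?xr // (val_neq0 xr). Qed.

Lemma val_real x : x != 0 -> exists r, w x = r%:E.
Proof. by move=> x0; exists (fine (w x)); rewrite val_fineK. Qed.

Lemma val_eq_exp r x n : w x = r%:E -> w (x ^+ n) = (n%:R * r)%:E.
Proof.
move=> xr; elim: n => [|n IHn]; first by rewrite expr0 val1 mul0r.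
by rewrite exprS (val_eq_mul xr IHn) -natr1; congr _%:E; lra.
Qed.

Lemma val_ge_exp r x n : (r%:E <= w x)%E -> ((n%:R * r)%R%:E <= w (x ^+ n)%R)%E.
Proof.
move=> xr; elim: n => [|n IHn]; first by rewrite expr0 val1 mul0r.
rewrite exprS; have := val_ge_mul xr IHn; congr (_%:E <= _)%E.
by rewrite -natr1; lra.
Qed.

Lemma val_exp_eq r x n : (0 < n)%N -> w (x ^+ n) = r%:E -> w x = (r / n%:R)%:E.
Proof.
move=> n0 xr; have n0R : n%:R != 0 :> R by rewrite pnatr_eq0 -lt0n.
have /val_real[s xs] : x != 0.
  by have := val_neq0 xr; apply: contraNneq => ->; rewrite expr0n gtn_eqF.
move: xr; rewrite (val_eq_exp n xs) => -[<-].
by rewrite xs; congr _%:E; rewrite mulrC mulKf.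
Qed.

Lemma val_nat n : (0 <= w n%:R%R)%E.
Proof.
elim: n => [|n IHn]; first by rewrite val0 le0y.
by rewrite -natr1 val_ge_add ?val1.
Qed.

(** If the sum had a larger valuation than x, so would x = (x + y) - y. *)
Lemma val_add_eq x y : (w x < w y)%E -> w (x + y) = w x.
Proof.
move=> xy; apply/eqP; rewrite eq_le andbC.
rewrite (le_trans _ (valD w x y)) ?le_min ?lexx ?(ltW xy) //=.
rewrite leNgt; apply/negP => xxy.
have := val_gt_sub xxy xy; rewrite addrK ltxx //.
Qed.

Lemma val_one_add x : (0 < w x)%E -> w (1 + x) = 0%E.
Proof. by move=> x0; rewrite val_add_eq val1. Qed.

End Estimates.

(** * Completeness and adding one dimension *)

Section Completeness.
Variables (R : realType) (F : fieldType) (w : valuation R F).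
Add Field F_field : (field_theory_F F).
Implicit Types (u : nat -> F) (x b : F).

Definition cauchy_seq u : Prop := forall B : R, exists N : nat,
  forall m n : nat, (N <= m)%N -> (N <= n)%N -> (B%:E < w (u m - u n)%R)%E.

Definition tends_to u x : Prop := forall B : R, exists N : nat,
  forall n : nat, (N <= n)%N -> (B%:E < w (u n - x)%R)%E.

Definition complete_in (V : {pred F}) : Prop :=
  forall u, (forall n, u n \in V) -> cauchy_seq u ->
  exists2 x, x \in V & tends_to u x.

Lemma tends_to_addM u1 u2 x1 x2 b : tends_to u1 x1 -> tends_to u2 x2 ->
  tends_to (fun n => u1 n + u2 n * b) (x1 + x2 * b).
Proof.
move=> lim1 lim2 B; have [N1 N1P] := lim1 B.
have [->|/(val_real w)[r br]] := eqVneq b 0.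
  by exists N1 => n /N1P; rewrite !mulr0 !addr0.
have [N2 N2P] := lim2 (B - r); exists (maxn N1 N2) => n.
rewrite geq_max => /andP[/N1P n1 /N2P n2].
have -> : u1 n + u2 n * b - (x1 + x2 * b) = (u1 n - x1) + (u2 n - x2) * b.
  by ring_F.
apply: val_gt_add => //; rewrite -[B](subrK r).
by apply: val_gt_mul; rewrite ?br.
Qed.

Lemma cauchy_seq_addM u1 u2 b : cauchy_seq u1 -> cauchy_seq u2 ->
  cauchy_seq (fun n => u1 n + u2 n * b).
Proof.
move=> c1 c2 B; have [N1 N1P] := c1 B.
have [->|/(val_real w)[r br]] := eqVneq b 0.
  by exists N1 => m n mN nN; rewrite !mulr0 !addr0; exact: N1P.
have [N2 N2P] := c2 (B - r); exists (maxn N1 N2) => m n.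
rewrite !geq_max => /andP[m1 m2] /andP[n1 n2].
have -> : u1 m + u2 m * b - (u1 n + u2 n * b) =
  (u1 m - u1 n) + (u2 m - u2 n) * b by ring_F.
apply: val_gt_add; first exact: N1P.
by rewrite -[B](subrK r); apply: val_gt_mul; [exact: N2P|rewrite br].
Qed.

Lemma val_infty x : (forall B : R, (B%:E < w x)%E) -> x = 0.
Proof.
move=> xB; apply/eqP; rewrite -[_ == _]negbK; apply/negP => /(val_real w)[r xr].
by have := xB r; rewrite xr ltxx.
Qed.

Lemma tends_to_uniq u x y : tends_to u x -> tends_to u y -> x = y.
Proof.
move=> ux uy; apply/eqP; rewrite -subr_eq0; apply/eqP/val_infty => B.
have [N NP] := ux B; have [N' NP'] := uy B.
have -> : x - y = (u (maxn N N') - y) - (u (maxn N N') - x) by ring_F.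
by apply: val_gt_sub; [apply: NP'|apply: NP]; rewrite ?leq_maxl ?leq_maxr.
Qed.

Lemma nat_above (B : R) : exists N : nat, forall n, (N <= n)%N -> B < n%:R.
Proof.
exists (Num.bound `|B|) => n Nn; apply: le_lt_trans (ler_norm B) _.
by apply: lt_le_trans (archi_boundP (normr_ge0 B)) _; rewrite ler_nat.
Qed.

(** A line added to a complete subspace V stays complete.  If b is not in V then
    b has a positive distance to V, since otherwise a sequence of V would
    converge to b; hence the coordinate of a vector along b is controlled by
    the vector, and Cauchy sequences can be treated coordinatewise. *)
Lemma complete_add_line (M : divringClosed F) (V : {pred F}) b :
    (forall m y y', m \in M -> y \in V -> y' \in V -> m * y + y' \in V) ->
    0 \in V -> complete_in M -> complete_in V ->
  complete_in (fun x => `[< exists y m, [/\ y \in V, m \in M & x = y + m * b] >]).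
Proof.
move=> Vlin V0 cM cV; set W := (fun x : F => _).
have [bV|bV] := boolP (b \in V).
  move=> u uW /cV[n|x xV ux]; last first.
    exists x => //; rewrite unfold_in; apply/asboolP; exists x, 0.
    by rewrite mul0r addr0 rpred0.
  have := uW n; rewrite unfold_in => /asboolP[y [m [yV mM ->]]].
  by rewrite addrC Vlin.
have [B bB] : exists B : R, forall y, y \in V -> (w (b - y)%R <= B%:E)%E.
  apply: contrapT => nB.
  have /choice[y yP] : forall n : nat, exists y, y \in V /\ (n%:R%:E < w (b - y)%R)%E.
    move=> n; apply: contrapT => nP; apply: nB; exists n%:R => y yV.
    by rewrite leNgt; apply/negP => yn; apply: nP; exists y.
  have yb : tends_to y b.
    move=> B; have [N NP] := nat_above B; exists N => n /NP nB'.
    by rewrite -valN opprB (lt_trans _ (yP n).2) // lte_fin.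
  have yc : cauchy_seq y.
    move=> B; have [N NP] := yb B; exists N => m n /NP mB /NP nB'.
    have -> : y m - y n = (y m - b) - (y n - b) by ring_F.
    exact: val_gt_sub.
  have [x xV /(tends_to_uniq yb) xb] := cV y (fun n => (yP n).1) yc.
  by rewrite xb xV in bV.
move=> u uW uc.
have /choice[y /choice[m ymP]] : forall n, exists y m,
    [/\ y \in V, m \in M & u n = y + m * b].
  by move=> n; have := uW n; rewrite unfold_in => /asboolP.
have mc : cauchy_seq m.
  move=> A; have [N NP] := uc (A + B); exists N => i j iN jN.
  have [->|mij] := eqVneq (m i - m j) 0; first by rewrite val0 ltry.
  have := NP i j iN jN; have [yi mi ->] := ymP i; have [yj mj ->] := ymP j.
  set d := m i - m j in mij *.
  have -> : y i + m i * b - (y j + m j * b) =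
      d * (b - (- d^-1 * y i + (d^-1 * y j + 0))).
    by rewrite /d; field_F; exact/eqP.
  rewrite valM; set z := (_ + (_ + 0)).
  have /bB : z \in V by rewrite /z !Vlin // ?rpredN ?rpredV ?rpredB.
  have [e ->] := val_real w mij; case: (w _) => [f||] //=.
  by rewrite -EFinD lee_fin !lte_fin => fB AB; lra.
have [x xM mx] := cM m (fun n => let: And3 _ h _ := ymP n in h) mc.
have yc : cauchy_seq y.
  have -> : y = fun n => u n + m n * (- b).
    by apply/funext => n; have [_ _ ->] := ymP n; ring_F.
  exact: cauchy_seq_addM.
have [z zV yz] := cV y (fun n => let: And3 h _ _ := ymP n in h) yc.
exists (z + x * b); first by rewrite unfold_in; apply/asboolP; exists z, x.
have -> : u = fun n => y n + m n * b.
  by apply/funext => n; have [_ _ ->] := ymP n.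
exact: tends_to_addM.
Qed.

End Completeness.

(** * Adjoining an algebraic element *)

Section AlgebraicAdjunction.
Variables (K F : fieldType) (iota : {rmorphism K -> F}).
Hypothesis F_algebraic : forall z : F, algebraicOver iota z.

(** A polynomial relation of x over K can be chosen with a nonzero constant
    term; it then expresses the inverse of x as a polynomial in x. *)
Lemma algebraic_subring_inv (E : subringClosed F) :
  (forall x, iota x \in E) -> {in E, forall x, x^-1 \in E}.
Proof.
move=> iotaE x xE; have [->|x0] := eqVneq x 0; first by rewrite invr0 rpred0.
have [q q0 qx] := F_algebraic x.
have [m [q' q'0 qE]] := multiplicity_XsubC q 0.
rewrite q0 /= in q'0.
have q'x : (map_poly iota q').[x] = 0.
  move: qx; rewrite qE polyC0 subr0 rmorphM rmorphXn /= map_polyX.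
  rewrite rootE hornerM hornerXn mulf_eq0 expf_eq0 (negPf x0) andbF orbF.
  by move/eqP.
have [s sE] : exists s, q' - q'.[0]%:P = s * 'X.
  have /factor_theorem[s] : root (q' - q'.[0]%:P) 0 by rewrite rootE !hornerE subrr.
  by rewrite polyC0 subr0; exists s.
have c0 : iota q'.[0] != 0 by rewrite fmorph_eq0.
have -> : x^-1 = (map_poly iota s).[x] * - (iota q'.[0])^-1.
  have := congr1 (fun p => (map_poly iota p).[x]) sE.
  rewrite rmorphB rmorphM /= map_polyX !map_polyC /= !hornerE q'x add0r => e.
  apply: (mulIf x0); rewrite mulVf //.
  by rewrite mulrAC -e mulrN mulNr opprK mulfV.
apply: rpredM; last by rewrite rpredN -fmorphV.
apply: rpred_horner xE.
by apply/polyOverP => i; rewrite coef_map; exact: iotaE.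
Qed.

Definition ring_adjoin (M : {pred F}) (z : F) : {pred F} :=
  fun x => `[< exists2 q : {poly F}, q \is a polyOver M & x = q.[z] >].

Lemma ring_adjoinP (M : {pred F}) z x :
  reflect (exists2 q : {poly F}, q \is a polyOver M & x = q.[z])
          (x \in ring_adjoin M z).
Proof. exact: asboolP. Qed.

Lemma ring_adjoin_subring (M : subringClosed F) z :
  GRing.subring_closed (ring_adjoin M z).
Proof.
split.
- by apply/ring_adjoinP; exists 1; rewrite ?rpred1 ?hornerC.
- move=> _ _ /ring_adjoinP[p pM ->] /ring_adjoinP[q qM ->].
  by apply/ring_adjoinP; exists (p - q); rewrite ?rpredB // !hornerE.
- move=> _ _ /ring_adjoinP[p pM ->] /ring_adjoinP[q qM ->].
  by apply/ring_adjoinP; exists (p * q); rewrite ?rpredM // hornerM.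
Qed.

Lemma sub_ring_adjoin (M : subringClosed F) z :
  {subset M <= ring_adjoin M z}.
Proof.
by move=> x xM; apply/ring_adjoinP; exists x%:P; rewrite ?polyOverC ?hornerC.
Qed.

Lemma ring_adjoin_gen (M : subringClosed F) z : z \in ring_adjoin M z.
Proof. by apply/ring_adjoinP; exists 'X; rewrite ?polyOverX ?hornerX. Qed.

Lemma ring_adjoin_min (M L : subringClosed F) z :
  {subset M <= L} -> z \in L -> {subset ring_adjoin M z <= L}.
Proof.
move=> ML zL _ /ring_adjoinP[q /polyOverP qM ->].
by rewrite rpred_horner //; apply/polyOverP => i; exact: ML.
Qed.

Lemma ring_adjoin_field (M : divringClosed F) z :
  (forall x, iota x \in M) -> exists M' : divringClosed F, M' =i ring_adjoin M z.
Proof.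
move=> iotaM; have [E1 EB EM] := ring_adjoin_subring M z.
pose Eb := GRing.isSubringClosed.Build F _ (ring_adjoin_subring M z).
pose E : subringClosed F := HB.pack (ring_adjoin M z) Eb.
have iotaE x : iota x \in E by exact/(@sub_ring_adjoin M z)/iotaM.
have EV := algebraic_subring_inv iotaE.
have Ed : GRing.divring_closed (ring_adjoin M z).
  by split=> // x y xE yE; apply: EM => //; exact: EV.
pose D := GRing.isDivringClosed.Build F _ Ed.
by exists (HB.pack (ring_adjoin M z) D : divringClosed F).
Qed.

End AlgebraicAdjunction.

Section PolynomialReduction.
Variables (F : fieldType) (M : divringClosed F).
Implicit Types (p q r : {poly F}).

(** Euclidean division by a monic polynomial does not leave the subfield M of the
    coefficients. *)
Lemma polyOver_divE q p : q \is monic -> q \is a polyOver M ->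
  p \is a polyOver M ->
  exists s r, [/\ s \is a polyOver M, r \is a polyOver M,
                  p = s * q + r & (size r < size q)%N].
Proof.
move=> qm qM; elim/poly_ind: p => [|p c IHp] pM.
  exists 0, 0; rewrite rpred0 mul0r addr0 size_poly0 lt0n size_poly_eq0.
  by rewrite monic_neq0.
have {}/IHp[s [r [sM rM pE rq]]] : p \is a polyOver M.
  apply/polyOverP => i; have /polyOverP/(_ i.+1) := pM.
  by rewrite coefD coefMX coefC addr0.
have cM : c \in M.
  by have /polyOverP/(_ 0%N) := pM; rewrite coefD coefMX coefC add0r.
pose d := (size q).-1; pose r' := r * 'X + c%:P.
have r'M : r' \is a polyOver M by rewrite rpredD ?rpredM ?polyOverX ?polyOverC.
exists (s * 'X + (r'`_d)%:P), (r' - (r'`_d)%:P * q); split.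
- by rewrite rpredD ?rpredM ?polyOverX ?polyOverC ?(polyOverP r'M).
- by rewrite rpredB ?rpredM ?polyOverX ?polyOverC ?(polyOverP r'M).
- by rewrite [X in _ = X + _]mulrDl -addrA subrKC /r' addrA mulrAC -mulrDl -pE.
- have dq : size q = d.+1 by rewrite prednK // (leq_trans _ rq).
  rewrite dq ltnS; apply/leq_sizeP => j; rewrite leq_eqVlt => /orP[/eqP<-|dj].
    rewrite coefB coefCM (_ : q`_d = 1) ?mulr1 ?subrr //; exact/eqP.
  rewrite coefB coefCM (_ : q`_j = 0); last by rewrite nth_default ?dq.
  have [j' jE] : exists j', j = j'.+1 by exists j.-1; rewrite prednK // (leq_trans _ dj).
  rewrite mulr0 subr0 coefD coefMX coefC jE /= addr0 nth_default //.
  by move: dj rq; rewrite jE dq !ltnS => dj /leq_trans; apply.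
Qed.

End PolynomialReduction.

(** * Completeness of finite extensions *)

Section CompleteAdjunction.
Variables (R : realType) (F : fieldType) (w : valuation R F).

Lemma complete_in_eq (V V' : {pred F}) :
  V =i V' -> complete_in w V -> complete_in w V'.
Proof.
move=> VV' cV u uV' uc; have uV n : u n \in V by rewrite VV'.
by have [x xV ux] := cV u uV uc; exists x; rewrite // -VV'.
Qed.

(** The span of 1, z, ..., z^(d-1) over M. *)
Definition polys_below (M : {pred F}) (z : F) (d : nat) : {pred F} :=
  fun x => `[< exists q : {poly F},
                 [/\ q \is a polyOver M, (size q <= d)%N & x = q.[z]] >].

Lemma polys_belowP (M : {pred F}) z d x :
  reflect (exists q : {poly F},
             [/\ q \is a polyOver M, (size q <= d)%N & x = q.[z]])
          (x \in polys_below M z d).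
Proof. exact: asboolP. Qed.

Lemma complete_polys_below (M : divringClosed F) z d :
  complete_in w M -> complete_in w (polys_below M z d).
Proof.
move=> cM; have V0 k : 0 \in polys_below M z k.
  by apply/polys_belowP; exists 0; rewrite rpred0 size_poly0 horner0.
elim: d => [|d IHd].
  move=> u u0 _; have {}u0 n : u n = 0.
    have /polys_belowP[q [_]] := u0 n.
    by rewrite leqn0 size_poly_eq0 => /eqP-> ->; rewrite horner0.
  by exists 0 => // B; exists 0%N => n _; rewrite u0 subr0 val0 ltry.
have Vlin m y y' : m \in M -> y \in polys_below M z d ->
    y' \in polys_below M z d -> m * y + y' \in polys_below M z d.
  move=> mM /polys_belowP[q [qM qd ->]] /polys_belowP[q' [q'M q'd ->]].
  apply/polys_belowP; exists (m *: q + q'); split.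
  - by rewrite -mul_polyC rpredD ?rpredM ?polyOverC.
  - rewrite (leq_trans (size_polyD _ _)) // geq_max q'd andbT.
    exact: leq_trans (size_scale_leq _ _) qd.
  - by rewrite !hornerE.
have := complete_add_line (b := z ^+ d) Vlin (V0 d) cM IHd.
apply: complete_in_eq => x.
apply/asboolP/polys_belowP => [[y [m [/polys_belowP[q [qM qd ->]] mM ->]]]|].
  exists (q + m *: 'X^d); split.
  - by rewrite -mul_polyC rpredD ?rpredM ?polyOverC ?polyOverXn.
  - rewrite (leq_trans (size_polyD _ _)) // geq_max (leq_trans qd) //=.
    by rewrite (leq_trans (size_scale_leq _ _)) ?size_polyXn.
  - by rewrite !hornerE.
move=> [q [qM qd ->]]; exists (\poly_(i < d) q`_i).[z], q`_d; split.
- apply/polys_belowP; exists (\poly_(i < d) q`_i); split; rewrite ?size_poly //.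
  by apply/polyOverP => i; rewrite coef_poly; case: ifP; rewrite ?rpred0 ?(polyOverP qM).
- exact/polyOverP.
- transitivity (\poly_(i < d) q`_i + q`_d *: 'X^d).[z]; last by rewrite !hornerE.
  congr (_.[z]); apply/polyP => i; rewrite coefD coef_poly coefZ coefXn.
  have [->|id] := eqVneq i d; first by rewrite ltnn mulr1 add0r.
  rewrite mulr0 addr0; case: ltnP => // di.
  by rewrite nth_default // (leq_trans qd) // ltn_neqAle eq_sym id.
Qed.

Lemma ring_adjoin_polys_below (M : divringClosed F) z q :
  q \is monic -> q \is a polyOver M -> root q z ->
  ring_adjoin M z =i polys_below M z (size q).-1.
Proof.
move=> qm qM /eqP qz x; apply/ring_adjoinP/polys_belowP.
  move=> [p pM ->]; have [s [r [sM rM -> rq]]] := polyOver_divE qm qM pM.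
  exists r; rewrite -ltnS prednK ?(leq_ltn_trans _ rq) //.
  by rewrite hornerD hornerM qz mulr0 add0r.
by move=> [p [pM _ ->]]; exists p.
Qed.

Variables (K : fieldType) (iota : {rmorphism K -> F}).
Hypothesis F_algebraic : forall z : F, algebraicOver iota z.

Lemma complete_ring_adjoin (M : divringClosed F) z :
  (forall x, iota x \in M) -> complete_in w M ->
  complete_in w (ring_adjoin M z).
Proof.
move=> iotaM cM; have /integral_algebraic[q qm qz] := F_algebraic z.
have qM : map_poly iota q \is a polyOver M.
  by apply/polyOverP => i; rewrite coef_map; exact: iotaM.
have := complete_polys_below (z := z) (d := (size q).-1) cM.
apply: complete_in_eq => x.
by rewrite (ring_adjoin_polys_below _ qM qz) ?monic_map ?size_map_poly.
Qed.

(** M' is the subfield generated by M and S; the universal property is what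
    makes successive adjunctions compose. *)
Definition adjunction (M : {pred F}) (S : set F) (M' : {pred F}) : Prop :=
  [/\ {subset M <= M'}, forall x : F, S x -> x \in M' &
      forall L : divringClosed F,
        {subset M <= L} -> (forall x : F, S x -> x \in L) -> {subset M' <= L}].

(** The predicate P records whatever invariant of the intermediate fields is
    preserved each time an element of s is adjoined. *)
Lemma ex_adjunction_seq (s : seq F) (M : divringClosed F)
    (P : divringClosed F -> Prop) :
  (forall x, iota x \in M) -> complete_in w M -> P M ->
  (forall (M1 M2 : divringClosed F) z, z \in s -> {subset M <= M1} ->
     complete_in w M1 -> P M1 -> M2 =i ring_adjoin M1 z -> P M2) ->
  exists M' : divringClosed F,
    [/\ adjunction M [set` s] M', complete_in w M' & P M'].
Proof.
elim: s M => [|z s IHs] M iotaM cM PM Pstep.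
  by exists M; split=> //; split.
have [M1 M1E] := ring_adjoin_field F_algebraic z iotaM.
have MM1 : {subset M <= M1} by move=> x xM; rewrite M1E sub_ring_adjoin.
have cM1 : complete_in w M1.
  have := complete_ring_adjoin (z := z) iotaM cM.
  by apply: complete_in_eq => x; rewrite M1E.
have PM1 : P M1 by apply: Pstep (PM) M1E => //; rewrite mem_head.
have [|M' [[M1M' sM' M'min] cM' PM']] := IHs M1 (fun x => MM1 _ (iotaM x)) cM1 PM1.
  move=> N1 N2 y ys M1N1; apply: Pstep; first by rewrite inE ys orbT.
  by move=> x /MM1/M1N1.
exists M'; split=> //; split.
- by move=> x /MM1/M1M'.
- move=> x /=; rewrite inE => /predU1P[->|/sM'//].
  by apply: M1M'; rewrite M1E ring_adjoin_gen.
- move=> L ML sL; apply: M'min => [x|x xs]; last by apply: sL; rewrite /= inE xs orbT.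
  by rewrite M1E; apply: ring_adjoin_min ML _ _; apply: sL; rewrite /= mem_head.
Qed.

End CompleteAdjunction.

(** * Roots of elements close to 1 *)

Section RootsNearOne.
Variables (R : realType) (F : fieldType) (w : valuation R F).
Add Field F_field4 : (field_theory_F F).
Variables (l : nat) (s : R).
Hypotheses (l_ge2 : (2 <= l)%N) (val_l : w l%:R = s%:E).
Hypothesis val_bin : forall i, (0 < i < l)%N -> (s%:E <= w 'C(l, i)%:R%R)%E.

(** The middle terms of the binomial expansion are divisible by l, with integral
    quotients. *)
Lemma expand_one_add_exp x : (0 <= w x)%E -> exists2 r, (0 <= w r)%E &
  (1 + x) ^+ l = 1 + l%:R * x + l%:R * x ^+ 2 * r + x ^+ l.
Proof.
move=> x0; have lN0 := val_neq0 val_l.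
exists (\sum_(2 <= i < l) ('C(l, i)%:R / l%:R) * x ^+ (i - 2)).
  rewrite big_nat_cond; apply: val_ge_sum => i /[!andbT] /andP[i2 il].
  have bi : ((s + - s)%R%:E <= w ('C(l, i)%:R / l%:R)%R)%E.
    by rewrite val_ge_mul ?(val_eq_inv val_l) // val_bin // il (ltnW i2).
  by have := val_ge_mul bi (val_ge_exp (i - 2) x0); rewrite subrr mulr0 addr0.
have [k lE] : exists k, l = k.+2 by exists l.-2; lia.
rewrite exprDn -(big_mkord xpredT (fun i => 1 ^+ (l - i) * x ^+ i *+ 'C(l, i))).
rewrite big_ltn // big_ltn 1?lE // -lE big_nat_recr //= expr0 expr1.
rewrite bin0 bin1 binn !expr1n !mul1r !mulr1n -[x *+ l]mulr_natl !addrA.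
congr (_ + _ + _); rewrite mulr_sumr; apply: eq_big_nat => i /andP[i2 il].
rewrite expr1n mul1r -mulr_natl -[in x ^+ i](subnKC i2) exprD.
move: (_ ^+ (i - 2)) ('C(l, i)%:R : F) (l%:R : F) lN0 => z b k' k'0.
by field_F; exact/eqP.
Qed.

Variable h : R.
Hypotheses (h_gt0 : 0 < h) (h_large : s < (l%:R - 1) * h).

Let g := Num.min h ((l%:R - 1) * h - s).

Let g_gt0 : 0 < g.
Proof. by rewrite lt_min h_gt0 subr_gt0. Qed.

(** The defect of 1 + x as an l-th root of 1 + l x: writing
    (1 + l x) / (1 + x)^l = 1 + l (defect x), a root of 1 + l (defect x) times
    1 + x is a root of 1 + l x. *)
Let defect (x : F) : F := ((1 + l%:R * x) / (1 + x) ^+ l - 1) / l%:R.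

(** By the expansion, - (1 + x)^l times the defect is x^2 r + x^l / l with r
    integral: the first term gains h and the second gains (l - 1) h - v l. *)
Lemma defect_gain x (r : R) : h <= r -> (r%:E <= w x)%E ->
  ((r + g)%R%:E <= w (defect x))%E.
Proof.
move=> hr rx; have r0 : 0 < r := lt_le_trans h_gt0 hr.
have x0 : (0 < w x)%E by apply: lt_le_trans rx; rewrite lte_fin.
have [t t0 tE] := expand_one_add_exp (ltW x0).
have u0 : w ((1 + x) ^+ l) = 0%E.
  by rewrite (val_eq_exp l (val_one_add x0)) mulr0.
have lN0 := val_neq0 val_l; have uN0 := val_neq0 u0.
have -> : defect x = - ((x ^+ 2 * t + x ^+ l * l%:R^-1) / (1 + x) ^+ l).
  have -> : x ^+ 2 * t + x ^+ l * l%:R^-1 =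
      ((1 + x) ^+ l - 1 - l%:R * x) / l%:R.
    rewrite tE; move: (x ^+ l) (l%:R : F) lN0 => z k k0.
    by field_F; exact/eqP.
  rewrite /defect; move: ((1 + x) ^+ l) (l%:R : F) uN0 lN0 => u k uN0 k0.
  by field_F; split; exact/eqP.
have l1 : (1 : R) <= l%:R - 1 by have := ler_nat R 2 l; rewrite l_ge2; lra.
rewrite valN -[_ + g]addr0 val_ge_mul ?(val_eq_inv u0) ?oppr0 // val_ge_add //.
- have := val_ge_mul (val_ge_exp 2 rx) t0; apply: le_trans.
  rewrite lee_fin addr0 /g; have : Num.min h ((l%:R - 1) * h - s) <= h.
    by rewrite ge_min lexx.
  by lra.
- have := val_ge_mul (val_ge_exp l rx) (_ : ((- s)%R%:E <= w l%:R^-1%R)%E).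
  rewrite (val_eq_inv val_l) => /(_ (lexx _)); apply: le_trans.
  have : Num.min h ((l%:R - 1) * h - s) <= (l%:R - 1) * h - s.
    by rewrite ge_min lexx orbT.
  by rewrite lee_fin -/g => gle; nra.
Qed.

(** The root is the infinite product of the 1 + x_n, where x_0 = d / l and
    x_(n+1) is the defect of x_n; each step gains at least g > 0. *)
Lemma root_near_one (M : divringClosed F) d : complete_in w M -> d \in M ->
  ((h + s)%R%:E <= w d)%E -> exists2 u, u \in M & u ^+ l = 1 + d.
Proof.
move=> cM dM hd; have lN0 := val_neq0 val_l.
pose x n := iter n defect (d / l%:R); pose u n := \prod_(i < n) (1 + x i).
have xM n : x n \in M.
  elim: n => [|n IHn]; first by rewrite rpred_div ?rpred_nat.
  by rewrite /= rpred_div ?rpredB ?rpred_div ?rpredX ?rpredD ?rpredM ?rpred1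
             ?rpred_nat.
have hx n : ((h + n%:R * g)%R%:E <= w (x n))%E.
  elim: n => [|n IHn].
    rewrite mul0r addr0 -[h](addrK s) val_ge_mul // (val_eq_inv val_l) //.
  have -> : h + n.+1%:R * g = h + n%:R * g + g.
    by rewrite -natr1 mulrDl mul1r addrA.
  by apply: defect_gain IHn; rewrite lerDl mulr_ge0 // ltW.
have x0 n : (0 < w (x n))%E.
  by apply: lt_le_trans (hx n); rewrite lte_fin ltr_wpDr // mulr_ge0 // ltW.
have w1x n : w (1 + x n) = 0%E by exact: val_one_add.
have uS n : u n.+1 = u n * (1 + x n) by rewrite /u big_ord_recr.
have uM n : u n \in M by rewrite rpred_prod // => i _; rewrite rpredD ?rpred1.
have wu n : w (u n) = 0%E.
  elim: n => [|n IHn]; first by rewrite /u big_ord0 val1.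
  by rewrite uS (val_eq_mul IHn (w1x n)) addr0.
(* The invariant of the iteration: what remains to be extracted from 1 + d is
   an l-th root of 1 + l x_n. *)
have uE n : u n ^+ l * (1 + l%:R * x n) = 1 + d.
  elim: n => [|n <-].
    by rewrite /u big_ord0 expr1n mul1r mulrC divfK.
  rewrite uS exprMn_comm; last exact: mulrC.
  have : (1 + x n) ^+ l != 0 by rewrite expf_neq0 // (val_neq0 (w1x n)).
  have -> : x n.+1 = defect (x n) by [].
  rewrite /defect; move: (u n ^+ l) ((1 + x n) ^+ l) (l%:R : F) lN0 => a b k k0 b0.
  by field_F; split; exact/eqP.
have uD n k : ((h + n%:R * g)%R%:E <= w (u (n + k)%N - u n)%R)%E.
  elim: k => [|k IHk]; first by rewrite addn0 subrr val0 leey.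
  rewrite addnS uS.
  have -> : u (n + k)%N * (1 + x (n + k)%N) - u n =
    u (n + k)%N * x (n + k)%N + (u (n + k)%N - u n) by ring_F.
  apply: val_ge_add => //; rewrite -[_ + _ * g]add0r val_ge_mul ?wu //.
  apply: le_trans (hx _); rewrite lee_fin lerD2l ler_wpM2r ?(ltW g_gt0) //.
  by rewrite ler_nat leq_addr.
have large (B : R) : exists N : nat, forall n, (N <= n)%N -> B < h + n%:R * g.
  have [N NP] := nat_above ((B - h) / g); exists N => n /NP.
  by rewrite ltr_pdivrMr // => ?; lra.
have uc : cauchy_seq w u.
  move=> B; have [N NP] := large B; exists N => m n Nm Nn.
  have -> : u m - u n = (u m - u N) - (u n - u N) by ring_F.
  have BN : (B%:E < (h + N%:R * g)%R%:E)%E by rewrite lte_fin NP.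
  rewrite -(subnKC Nm) -(subnKC Nn).
  by apply: val_gt_sub; apply: lt_le_trans BN (uD _ _).
have [y yM uy] := cM u uM uc.
exists y => //; apply/eqP; rewrite -subr_eq0; apply/eqP/(val_infty (w := w)) => B.
have wy : (0 <= w y)%E.
  have [N /(_ N (leqnn N)) NP] := uy 0; rewrite -(subKr (u N) y).
  by rewrite val_ge_sub ?wu // ltW.
have [N1 N1P] := uy B; have [N2 N2P] := large (B - s).
pose n := maxn N1 N2.
have -> : y ^+ l - (1 + d) = - (u n ^+ l * (l%:R * x n)) - (u n ^+ l - y ^+ l).
  by rewrite -(uE n); move: (u n ^+ l) (y ^+ l) (l%:R : F) => a b k; ring_F.
apply: val_gt_sub; first rewrite valN.
  have BN : B < s + (h + n%:R * g) by rewrite -ltrBlDl N2P ?leq_maxr.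
  have wl : (s%:E <= w l%:R)%E by rewrite val_l.
  rewrite valM (val_eq_exp l (wu n)) mulr0 add0e.
  by apply: lt_le_trans (val_ge_mul wl (hx n)); rewrite lte_fin.
rewrite subrXX -[B]addr0; apply: val_gt_mul; first by rewrite N1P ?leq_maxl.
apply: val_ge_sum => i _.
have wun : (0%:E <= w (u n))%E by rewrite wu.
have := val_ge_mul (val_ge_exp (l.-1 - i) wun) (val_ge_exp i wy).
by rewrite !mulr0 addr0.
Qed.

(** Any two l-th roots of the same element differ by a root of unity, so y / m
    is the root found in M by [root_near_one] times a root of unity of M. *)
Lemma mem_of_exp_near (M : divringClosed F) y m :
  complete_in w M -> (forall z, z ^+ l = 1 -> z \in M) ->
  y ^+ l \in M -> m \in M -> m != 0 ->
  ((h + s)%R%:E <= w (y ^+ l / m ^+ l - 1)%R)%E -> y \in M.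
Proof.
move=> cM muM ylM mM m0; set d := _ - 1 => hd.
have dM : d \in M by rewrite rpredB ?rpred1 // rpred_div // rpredX.
have [u uM uE] := root_near_one cM dM hd.
have s0 : 0 <= s by have := val_nat w l; rewrite val_l lee_fin.
have u0 : u != 0.
  have : w (1 + d) = 0%E.
    apply: val_one_add; apply: lt_le_trans hd; rewrite lte_fin.
    by rewrite ltr_wpDr.
  move=> /val_neq0; rewrite -uE; apply: contraNneq => ->.
  by rewrite expr0n gtn_eqF // (ltnW l_ge2).
have e : y ^+ l = (m * u) ^+ l.
  by rewrite exprMn uE /d addrC subrK mulrC divfK // expf_neq0.
have -> : y = m * u * (y / (m * u)) by rewrite mulrC divfK ?mulf_neq0.
apply: rpredM; first exact: rpredM.
by apply: muM; rewrite expr_div_n e divff // expf_neq0 ?mulf_neq0.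
Qed.

End RootsNearOne.

(** * Valuations along a chain of preimages *)

Section PreimageTower.
Variables (R : realType) (F : fieldType) (w : valuation R F).
Add Field F_field5 : (field_theory_F F).
Variables (l : nat) (a c : F) (C : R).
Hypotheses (l_ge2 : (2 <= l)%N) (C_gt0 : 0 < C).
Hypotheses (val_c : w c = (- C)%:E).
Hypothesis val_a : ((- (C / l%:R))%R%:E <= w a)%E.

Let f (z : F) : F := z ^+ l - c.

Let C_l : C / l%:R < C.
Proof.
by rewrite ltr_pdivrMr ?ltr0n ?(ltnW l_ge2) // ltr_pMr // ltr1n.
Qed.

(** In z^l = f z + c the term c dominates, because v (f z) >= - C / l > - C. *)
Lemma val_exp_preimage m z : iter m.+1 f z = a -> w (z ^+ l) = (- C)%:E.
Proof.
elim: m z => [|m IHm] z; rewrite iterSr.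
  move=> /= fza; rewrite -(subrK c (z ^+ l)) -/(f z) fza addrC val_add_eq ?val_c //.
  by apply: lt_le_trans val_a; rewrite lte_fin ltrN2.
move=> /IHm /(val_exp_eq (ltnW l_ge2)) fz.
rewrite -(subrK c (z ^+ l)) -/(f z) addrC val_add_eq ?val_c ?fz //.
by rewrite lte_fin mulNr ltrN2.
Qed.

Lemma val_preimage m z : iter m.+1 f z = a -> w z = (- (C / l%:R))%:E.
Proof. by move/val_exp_preimage/(val_exp_eq (ltnW l_ge2)); rewrite mulNr. Qed.

Lemma val_preimage_ge m z : iter m f z = a -> ((- (C / l%:R))%R%:E <= w z)%E.
Proof. by case: m => [/= ->|m /val_preimage ->]. Qed.

(** Both numerator and denominator of (z / f z)^l are shifted by c:
    (z / f z)^l - 1 = (f z - f (f z)) / (f z)^l, and (f z)^l has valuation - C. *)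
Lemma val_ratio_preimage m z r : iter m.+2 f z = a ->
  ((r - C / l%:R)%R%:E <= w (f z - f (f z))%R)%E ->
  ((r + (C - C / l%:R))%R%:E <= w (z ^+ l / f z ^+ l - 1)%R)%E.
Proof.
rewrite iterSr => /val_exp_preimage fzl rd.
have -> : z ^+ l / f z ^+ l - 1 = (f z - f (f z)) / f z ^+ l.
  have := val_neq0 fzl; rewrite /f; move: (z ^+ l) => y.
  move: ((y - c) ^+ l) => x x0.
  by field_F; exact/eqP.
have -> : r + (C - C / l%:R) = r - C / l%:R + - - C by lra.
by rewrite val_ge_mul // (val_eq_inv fzl).
Qed.

Lemma val_ratio_preimage_ge m z : iter m.+2 f z = a ->
  ((C - C / l%:R)%R%:E <= w (z ^+ l / f z ^+ l - 1)%R)%E.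
Proof.
move=> za; rewrite -[_ - _]add0r (val_ratio_preimage za) // sub0r.
by move: za; rewrite iterSr => za; rewrite val_ge_sub ?(val_preimage_ge za) //;
   move: za; rewrite iterSr => za; rewrite ?(val_preimage_ge za).
Qed.

End PreimageTower.

Section WildEstimates.
Variables (R : realType) (F : fieldType) (w : valuation R F).
Add Field F_field6 : (field_theory_F F).
Variable p : nat.
Hypotheses (p_prime : prime p) (val_p : w p%:R = 1%E).

Lemma val_bin_prime i : (0 < i < p)%N -> (1 <= w 'C(p, i)%:R%R)%E.
Proof.
move=> /(prime_dvd_bin p_prime) /dvdnP[k ->].
by rewrite natrM valM val_p leeDr // val_nat.
Qed.

Let p1_gt0 : 0 < p%:R - 1 :> R.
Proof. by rewrite subr_gt0 ltr1n prime_gt1. Qed.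

Let p_gt0 : 0 < p%:R :> R.
Proof. by rewrite ltr0n prime_gt0. Qed.

(** If v e were less than D / p, then e^p would be the dominant term of
    (1 + e)^p - 1: the other terms have valuation at least 1 + v e, which is
    more than p (v e) because v e < 1 / (p - 1).  So v d = p (v e) < D.
    (Here v e >= 0, as 1 + e is a root of the integral element 1 + d.) *)
Lemma val_ge_of_exp e d (D : R) : (1 + e) ^+ p = 1 + d ->
  0 <= D -> D <= p%:R / (p%:R - 1) -> (D%:E <= w d)%E ->
  ((D / p%:R)%R%:E <= w e)%E.
Proof.
move=> ed D0 Dp Dd; rewrite leNgt; apply/negP => eD.
have [r er] : exists r, w e = r%:E.
  by apply: val_real; apply: contraTneq eD => ->; rewrite val0 -leNgt leey.
move: eD; rewrite er lte_fin ltr_pdivlMr // => rD.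
have [r0|r0] := ltP r 0.
  have w1e : w (1 + e) = r%:E.
    by rewrite addrC val_add_eq ?er ?val1 // lte_fin.
  have : (0 <= w (1 + d)%R)%E by rewrite val_ge_add ?val1 // (le_trans _ Dd) ?lee_fin.
  by rewrite -ed (val_eq_exp p w1e) lee_fin pmulr_rge0 // leNgt r0.
have e0 : (0 <= w e)%E by rewrite er lee_fin.
have [t t0 tE] := expand_one_add_exp (prime_gt1 p_prime) val_p val_bin_prime e0.
have dE : d = e ^+ p + p%:R * e * (1 + e * t).
  have -> : d = (1 + e) ^+ p - 1 by rewrite ed addrC addKr.
  by rewrite tE; move: (e ^+ p) (p%:R : F) => x k; ring_F.
have epE : w (e ^+ p) = (p%:R * r)%:E by exact: val_eq_exp.
have rest : ((1 + r + 0)%R%:E <= w (p%:R * e * (1 + e * t))%R)%E.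
  rewrite val_ge_mul ?val_ge_mul ?val_p ?er // val_ge_add ?val1 //.
  by rewrite -[0]addr0 val_ge_mul // er lee_fin.
have rp : p%:R * r < 1 + r.
  have : D * (p%:R - 1) <= p%:R by rewrite -ler_pdivlMr.
  by move: p1_gt0 p_gt0; nra.
move: Dd; rewrite dE val_add_eq epE; first by rewrite lee_fin leNgt mulrC rD.
by apply: lt_le_trans rest; rewrite addr0 lte_fin.
Qed.

(** The lower bound for v d_n.  The first term solves the recursion
    D_(n+1) = D_n / p + (C - C / p) from D_1 = C - C / p; the second is what the
    recursion gives from D_n = p / (p - 1), beyond which an estimate for 1 + d
    improves only one of its p-th roots. *)
Definition wild_bound (C : R) (n : nat) : R :=
  Num.min (C * (1 - p%:R^-1 ^+ n)) ((p%:R - 1)^-1 + C * (1 - p%:R^-1)).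

(** The hypothesis on C says that the second term of the bound is itself at least
    p / (p - 1), so that the minimum is stable under the recursion. *)
Lemma wild_bound_step (C : R) (n : nat) : p%:R / (p%:R - 1) <= C ->
  wild_bound C n.+1 <=
  Num.min (wild_bound C n) (p%:R / (p%:R - 1)) / p%:R + (C - C / p%:R).
Proof.
rewrite /wild_bound exprS; set P : R := p%:R; set q := P^-1; set t := (P - 1)^-1.
set Q := q ^+ n => eC.
have Pq : P * q = 1 by rewrite mulfV // gt_eqF.
have Pt : (P - 1) * t = 1 by rewrite mulfV // gt_eqF.
have tq : t * (1 - q) = q.
  by apply: (mulfI (lt0r_neq0 p1_gt0)); rewrite mulrA Pt mulrBl Pq; lra.
have q0 : 0 < q by rewrite invr_gt0.
have Ct : t <= C * q.
  by move: (ler_wpM2r (ltW q0) eC); rewrite -mulrA [t * q]mulrC mulrA Pq mul1r.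
rewrite -/q; set u := Num.min (Num.min _ _) _.
have [->|[->|->]] : u = C * (1 - Q) \/ u = t + C * (1 - q) \/ u = P * t.
  by rewrite /u /Num.min; do 2 case: ifP; auto.
- by rewrite ge_min; apply/orP; left; lra.
- rewrite ge_min; apply/orP; right.
  have : (C * q - t) * (1 - q) >= 0.
    rewrite mulr_ge0 ?subr_ge0 // invf_le1 //; move: p1_gt0; lra.
  by nra.
- rewrite ge_min; apply/orP; right.
  by rewrite mulrAC Pq mul1r; lra.
Qed.

Lemma wild_cap_gt (C : R) : p%:R / (p%:R - 1) < C ->
  p%:R / (p%:R - 1) < (p%:R - 1)^-1 + C * (1 - p%:R^-1).
Proof.
move=> eC; have : 1 < C * (1 - p%:R^-1).
  have -> : 1 - p%:R^-1 = (p%:R - 1) / p%:R :> R.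
    by rewrite mulrBl mulfV ?gt_eqF // mul1r.
  by rewrite mulrA ltr_pdivlMr // mul1r; move: eC; rewrite ltr_pdivrMr.
have -> : p%:R / (p%:R - 1) = 1 + (p%:R - 1)^-1 :> R.
  by rewrite -{1}(subrK 1 p%:R) mulrDl mulfV ?gt_eqF // mul1r.
by lra.
Qed.

Variables (a c : F) (C : R).
Hypotheses (val_c : w c = (- C)%:E).
Hypothesis val_a : ((- (C / p%:R))%R%:E <= w a)%E.
Hypothesis C_ge : p%:R / (p%:R - 1) <= C.

Let f (z : F) : F := z ^+ p - c.

(** Induction along the chain: with 1 + e = f z / f (f z), the bound for
    (1 + e)^p - 1 gives one for e by [val_ge_of_exp], hence one for
    f z - f (f z) = e f (f z). *)
Lemma val_ratio_wild n z : iter n.+2 f z = a ->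
  ((wild_bound C n.+1)%:E <= w (z ^+ p / f z ^+ p - 1)%R)%E.
Proof.
have p2 := prime_gt1 p_prime.
have C_gt0 : 0 < C by apply: lt_le_trans C_ge; rewrite divr_gt0.
have e_ge0 : 0 <= p%:R / (p%:R - 1) :> R by rewrite divr_ge0 ?ltW.
have q1 : p%:R^-1 < 1 :> R by rewrite invf_lt1 // ltr1n.
have q0 : 0 < p%:R^-1 :> R by rewrite invr_gt0.
elim: n z => [|n IHn] z za.
  apply: le_trans (val_ratio_preimage_ge p2 C_gt0 val_c val_a za).
  by rewrite lee_fin /wild_bound expr1 ge_min mulrBr mulr1 lexx.
have fza : iter n.+2 f (f z) = a by rewrite -iterSr.
have ffza : iter n.+1 f (f (f z)) = a by rewrite -!iterSr.
have ratio := IHn _ fza; set d := _ - 1 in ratio.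
have wffz := val_preimage p2 C_gt0 val_c val_a ffza.
have ffz0 := val_neq0 wffz.
pose e := f z / f (f z) - 1.
have ed : (1 + e) ^+ p = 1 + d.
  by rewrite /e /d ![1 + (_ - _)]addrC !subrK expr_div_n.
(* [val_ge_of_exp] only uses the part of the bound below p / (p - 1). *)
pose D := Num.min (wild_bound C n.+1) (p%:R / (p%:R - 1)).
have D0 : 0 <= D.
  rewrite le_min e_ge0 andbT le_min; apply/andP; split.
    by rewrite mulr_ge0 ?(ltW C_gt0) // subr_ge0 exprn_ile1 // ltW.
  by rewrite addr_ge0 ?invr_ge0 ?(ltW p1_gt0) // mulr_ge0 ?(ltW C_gt0) ?subr_ge0 ?ltW.
have De : D <= p%:R / (p%:R - 1) by rewrite ge_min lexx orbT.
have Dd : (D%:E <= w d)%E by apply: le_trans ratio; rewrite lee_fin ge_min lexx.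
have we := val_ge_of_exp ed D0 De Dd.
apply: le_trans (val_ratio_preimage p2 C_gt0 val_c val_a za (r := D / p%:R) _).
  by rewrite lee_fin wild_bound_step.
have -> : f z - f (f z) = e * f (f z) by rewrite /e mulrBl mul1r divfK.
by rewrite val_ge_mul // wffz.
Qed.

End WildEstimates.

(** * Artin-Schreier equations *)

Section ArtinSchreier.
Variables (k : fieldType) (p : nat).
Hypothesis pchar_k : p \in [pchar k].

Lemma pchar_nat_eq0 n : (0 < n < p)%N -> n%:R != 0 :> k.
Proof. by case/andP=> n0 np; rewrite -(dvdn_pcharf pchar_k) gtnNdvd. Qed.

Lemma artin_schreier_roots (t : k) :
  'X^p - 'X - (t ^+ p - t)%:P =
  \prod_(x <- [seq t + i%:R | i <- iota 0 p]) ('X - x%:P).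
Proof.
have p_prime := pcharf_prime pchar_k; have p1 := prime_gt1 p_prime.
have sizeXp : size ('X^p - 'X - (t ^+ p - t)%:P) = p.+1.
  by rewrite -addrA size_polyDl size_polyXn // -opprD size_polyN size_XaddC ltnS.
have monic_AS : 'X^p - 'X - (t ^+ p - t)%:P \is monic.
  rewrite monicE lead_coefE sizeXp /= !coefB coefXn coefX coefC eqxx.
  by rewrite !gtn_eqF ?(ltnW p1) // !subr0.
rewrite [LHS](@all_roots_prod_XsubC _ _ [seq t + i%:R | i <- iota 0 p]).
- by rewrite (monicP monic_AS) scale1r.
- by rewrite sizeXp size_map size_iota.
- apply/allP => _ /mapP[i _ ->]; rewrite rootE !hornerE.
  have := pFrobenius_autD_comm pchar_k (mulrC t i%:R).
  rewrite pFrobenius_aut_nat !pFrobenius_autE => ->.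
  by rewrite opprD addrACA subrr addr0 subrr.
- rewrite uniq_rootsE map_inj_in_uniq ?iota_uniq // => i j.
  rewrite !mem_iota /= add0n => ip jp /addrI.
  wlog ij : i j ip jp / (i <= j)%N => [hw e|].
    by case/orP: (leq_total i j) => ij; [|apply/esym]; apply: hw.
  move=> /eqP; rewrite eq_sym -subr_eq0 -natrB // => ji; apply/eqP.
  rewrite eqn_leq ij -subn_eq0; apply: contraLR ji; rewrite -lt0n => ji.
  by rewrite pchar_nat_eq0 // ji (leq_ltn_trans (leq_subr _ _)).
Qed.

(** A relation of least degree d < p divides X^p - X - alpha, whose roots are the
    t + i; so the sum of its roots is d t plus an element of the prime field.
    This sum is a coefficient, and d is invertible, which puts t in E. *)
Lemma artin_schreier_free (E : divringClosed k) (t : k) :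
  t \notin E -> t ^+ p - t \in E ->
  forall q : {poly k}, q \is a polyOver E -> (size q <= p)%N -> root q t -> q = 0.
Proof.
move=> tE asE; have p_prime := pcharf_prime pchar_k.
apply: contrapT => /existsNP[q0 /not_implyP[q0E /not_implyP[q0p /not_implyP[q0t /eqP q00]]]].
pose bad n := `[< exists q : {poly k},
  [/\ q \is a polyOver E, root q t, q != 0 & size q = n] >].
have ex_bad : exists n, bad n by exists (size q0); apply/asboolP; exists q0.
have [n /asboolP[q1 [q1E q1t q10 q1n]] n_min] := ex_minnP ex_bad.
have np : (n <= p)%N.
  by apply: leq_trans q0p; apply: n_min; apply/asboolP; exists q0.
pose q := (lead_coef q1)^-1 *: q1.
have c0 : (lead_coef q1)^-1 != 0 by rewrite invr_eq0 lead_coef_eq0.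
have qE : q \is a polyOver E.
  by rewrite polyOverZ // rpredV lead_coefE (polyOverP q1E).
have qm : q \is monic by rewrite monicE lead_coefZ mulVf // lead_coef_eq0.
have qn : size q = n by rewrite size_scale.
have /eqP qt : root q t by rewrite rootZ.
pose AS := 'X^p - 'X - (t ^+ p - t)%:P.
have ASE : AS \is a polyOver E.
  by rewrite !rpredB ?polyOverXn ?polyOverX ?polyOverC.
have [s [r [sE rE ASq rq]]] := polyOver_divE qm qE ASE.
have r0 : r = 0.
  apply/eqP; apply: contraLR rq => r0; rewrite -leqNgt qn; apply: n_min.
  apply/asboolP; exists r; split=> //.
  have : AS.[t] = (s * q + r).[t] by rewrite ASq.
  by rewrite [RHS]hornerD [in RHS]hornerM qt mulr0 add0r /AS !hornerE subrr => /esym/eqP.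
have /dvdp_prod_XsubC[m] : q %| \prod_(x <- [seq t + i%:R | i <- iota 0 p]) ('X - x%:P).
  by rewrite -artin_schreier_roots -/AS ASq r0 addr0 dvdp_mull.
set rs := mask m _; rewrite eqp_monic ?monic_prod_XsubC // => /eqP qrs.
have srs : n = (size rs).+1 by rewrite -qn qrs size_prod_XsubC.
have rs0 : size rs != 0%N.
  apply/eqP => rs0; move: qt; rewrite qrs (size0nil rs0) big_nil hornerC => /eqP.
  by rewrite oner_eq0.
have sum_rs : \sum_(x <- rs) x - t *+ size rs \in E.
  have : all (fun x => x - t \in E) rs.
    apply/allP => x /mem_mask /mapP[i _ ->].
    by rewrite addrC addKr rpred_nat.
  elim: (rs) => [_|x l IHl /= /andP[xE /IHl lE]]; first by rewrite big_nil subrr rpred0.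
  by rewrite big_cons mulrS opprD addrACA rpredD.
have /negP[] := tE.
have nE : t *+ size rs \in E.
  rewrite -[t *+ _](subKr (\sum_(x <- rs) x)) rpredB // -rpredN.
  by rewrite -coefPn_prod_XsubC // -qrs (polyOverP qE).
have n0 : (size rs)%:R != 0 :> k.
  by rewrite pchar_nat_eq0 // lt0n rs0 /= -srs.
by rewrite -(mulfK n0 t) mulr_natr rpred_div ?rpred_nat.
Qed.

End ArtinSchreier.

(** * Residues *)

Section Residues.
Variables (R : realType) (F : fieldType) (w : valuation R F).

Lemma ex_integer x : (0 <= w x)%E -> exists X : integers w, val X = x.
Proof. by move=> x0; exists (Integer (x0 : x \in integral_pred w)). Qed.

Lemma pchar_residue p : prime p -> (0 < w p%:R)%E -> p \in [pchar residue_field w].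
Proof.
move=> p_prime p0; rewrite inE p_prime /=.
by rewrite -(rmorph_nat (@residue R F w)) residue_eq0 rmorph_nat.
Qed.

Lemma ex_residue_subfield (M : divringClosed F) :
  exists E : divringClosed (residue_field w),
    forall t, (t \in E) <-> residue_set [set` M] t.
Proof.
pose E (t : residue_field w) := `[< residue_set [set` M] t >].
have Ed : GRing.divring_closed (E : {pred residue_field w}).
  split.
  - by apply/asboolP; exists 1; rewrite ?rmorph1 //= rpred1.
  - move=> _ _ /asboolP[x xM <-] /asboolP[y yM <-]; apply/asboolP.
    by exists (x - y); rewrite ?rmorphB //= rpredB.
  - move=> _ _ /asboolP[x xM <-] /asboolP[y yM <-]; apply/asboolP.
    have [->|y0] := eqVneq (residue y) 0.
      by exists 0; rewrite ?rmorph0 ?invr0 ?mulr0 //= rpred0.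
    have vy : w (val y) = 0%E.
      apply/eqP; rewrite eq_le leNgt -residue_eq0 y0 /=; exact: integerP.
    have yN0 := val_neq0 vy.
    have [z zE] : exists z : integers w, val z = (val y)^-1.
      by apply: ex_integer; rewrite (val_eq_inv vy) oppr0.
    have : val x / val y \in M by exact: rpred_div xM yM.
    rewrite -zE => xzM; exists (x * z) => //.
    rewrite rmorphM; congr (_ * _); apply: (mulfI y0); rewrite mulfV // -rmorphM.
    by rewrite -(rmorph1 (@residue R F w)); congr residue; apply: val_inj;
       rewrite rmorphM rmorph1 /= zE mulfV.
pose D := GRing.isDivringClosed.Build _ _ Ed.
exists (HB.pack (E : {pred residue_field w}) D : divringClosed _) => t.
by split => [/asboolP|?] //; apply/asboolP.
Qed.

Lemma lift_poly (q : {poly F}) : (forall i, 0 <= w q`_i)%E ->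
  exists Q : {poly integers w}, map_poly val Q = q.
Proof.
move=> q0; exists (\poly_(i < size q) insubd 0 q`_i).
apply/polyP => i; rewrite coef_map coef_poly; case: ltnP => iq.
  by rewrite /= insubdK //; exact: q0.
by rewrite nth_default.
Qed.

Lemma ex_min_coef (q : {poly F}) : q != 0 ->
  exists2 j, q`_j != 0 & forall i, (0 <= w (((q`_j)^-1 *: q)`_i)%R)%E.
Proof.
move=> q0; have sq0 : (0 < size q)%N by rewrite size_poly_gt0.
have pq : ((size q).-1 < size q)%N by rewrite prednK.
have [j _ jmin] := @arg_minP _ _ _ (Ordinal pq) xpredT (fun i => w q`_i) isT.
have qj0 : q`_j != 0.
  have := jmin (Ordinal pq) isT; rewrite -/(lead_coef q).
  apply: contraTneq => ->; rewrite val0 leye_eq val_eqy lead_coef_eq0 //.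
exists j => // i; rewrite coefZ; have [r jr] := val_real w qj0.
have [iq|iq] := ltnP i (size q); last by rewrite [q`_i]nth_default // mulr0 val0 leey.
have := jmin (Ordinal iq) isT; rewrite /= jr => ri.
have jV : ((- r)%R%:E <= w (q`_j)^-1%R)%E by rewrite (val_eq_inv jr).
by have := val_ge_mul jV ri; rewrite addNr.
Qed.

(** Scale q so that its coefficients are integral and one of them is 1.  Its
    reduction is then a nonzero polynomial of size at most that of q, which does
    not vanish at the residue of T: the scaled value at T is a unit. *)
Lemma val_horner_free (M : divringClosed F) (Ek : divringClosed (residue_field w))
    (T : integers w) (q : {poly F}) :
  (forall t, t \in Ek <-> residue_set [set` M] t) ->
  (forall P : {poly residue_field w}, P \is a polyOver Ek ->
     (size P <= size q)%N -> root P (residue T) -> P = 0) ->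
  q \is a polyOver M -> exists2 b, b \in M & w q.[val T] = w b.
Proof.
move=> EkP Tfree qM; have [->|q0] := eqVneq q 0.
  by exists 0; rewrite ?rpred0 ?horner0.
have [j b0 q'0] := ex_min_coef q0; set b := q`_j in b0 q'0.
have bM : b \in M by exact/polyOverP.
have [r br] := val_real w b0.
pose q' := b^-1 *: q.
have [Q QE] : exists Q : {poly integers w}, map_poly val Q = q' := lift_poly q'0.
have coefQ i : val Q`_i = b^-1 * q`_i by rewrite -coefZ -/q' -QE coef_map.
have QT : val Q.[T] = b^-1 * q.[val T] by rewrite -horner_map QE hornerZ.
have wQT : w (val Q.[T]) = 0%E.
  apply/eqP; rewrite eq_le leNgt -residue_eq0 -horner_map /= -rootE.
  have -> /= : ~~ root (map_poly (@residue R F w) Q) (residue T).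
    apply/negP => /Tfree Q0.
    have /polyP/(_ j) : map_poly (@residue R F w) Q = 0.
      apply: Q0.
        apply/polyOverP => i; rewrite coef_map; apply/EkP; exists Q`_i => //=.
        by rewrite coefQ rpredM ?rpredV ?(polyOverP qM).
      apply/leq_sizeP => i iq; rewrite coef_map /=.
      by rewrite (_ : Q`_i = 0) ?rmorph0 //; apply: val_inj;
         rewrite coefQ nth_default // mulr0 rmorph0.
    have Qj : Q`_j = 1 by apply: val_inj; rewrite coefQ mulVf // rmorph1.
    rewrite coef_map coef0 Qj /= => /eqP.
    by rewrite (rmorph1 (@residue R F w)) oner_eq0.
  exact: integerP.
exists b => //; rewrite -[q.[_]](mulVKf b0) -QT.
by rewrite (val_eq_mul br wQT) addr0 br.
Qed.

End Residues.

(** * Kummer extensions close to the base field *)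

(** A root of 1 + X + ... + X^(p-1) other than 1, since the value at 1 is p. *)
Lemma ex_root_of_unity (F : closedFieldType) (p : nat) :
  prime p -> p%:R != 0 :> F -> exists2 z : F, z != 1 & z ^+ p = 1.
Proof.
move=> p_prime p0.
have /closed_rootP[z zP] : size (\poly_(i < p) (1 : F)) != 1%N.
  by rewrite size_poly_eq ?oner_neq0 // gtn_eqF ?prime_gt1.
have zE : \sum_(i < p) z ^+ i = 0.
  have -> : \sum_(i < p) z ^+ i = (\poly_(i < p) (1 : F)).[z].
    by rewrite horner_poly; apply: eq_bigr => i _; rewrite mul1r.
  exact/eqP.
exists z; last by apply/eqP; rewrite -subr_eq0 subrX1 zE mulr0.
apply/eqP => z1; have /eqP[] := p0; rewrite -zE z1.
under eq_bigr do rewrite expr1n.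
by rewrite sumr_const card_ord.
Qed.

Section KummerStep.
Variables (R : realType) (F : fieldType) (w : valuation R F) (p : nat).
Add Field F_field7 : (field_theory_F F).
Hypotheses (p_prime : prime p) (val_p : w p%:R = 1%E).

Let p1_gt0 : 0 < p%:R - 1 :> R.
Proof. by rewrite subr_gt0 ltr1n prime_gt1. Qed.

Let p_gt0 : 0 < p%:R :> R.
Proof. by rewrite ltr0n prime_gt0. Qed.

Let expand e := expand_one_add_exp (prime_gt1 p_prime) val_p
  (val_bin_prime p_prime val_p) (x := e).

(** Expanding (1 + x)^p = 1 for x = z - 1 gives x^(p-1) = - p (1 + x t) with t
    integral. *)
Lemma val_root_of_unity_sub1 (z : F) : z != 1 -> z ^+ p = 1 ->
  w (z - 1) = ((p%:R - 1)^-1)%:E /\ (0 < w (p%:R / (z - 1) ^+ p.-1 + 1)%R)%E.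
Proof.
move=> z1 zp; set x := z - 1; have x0 : x != 0 by rewrite subr_eq0.
have wz : w z = 0%E.
  by rewrite (@val_exp_eq _ _ w 0 z p) ?mul0r ?prime_gt0 // zp val1.
have wx : (0 <= w x)%E by rewrite val_ge_sub ?val1 ?wz.
have [t t0 tE] := expand wx.
have xpE : x ^+ p.-1 = - (p%:R * (1 + x * t)).
  have xE : x ^+ p = x * x ^+ p.-1 by rewrite -exprS prednK ?prime_gt0.
  move: tE; rewrite addrC subrK zp xE; move: (x ^+ p.-1) (p%:R : F) => y k e.
  apply: (mulfI x0); apply/eqP; rewrite -subr_eq0; apply/eqP.
  have -> : x * y - x * - (k * (1 + x * t)) =
    (1 + k * x + k * x ^+ 2 * t + x * y) - 1 by ring_F.
  by rewrite -e subrr.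
have wx0 : (0 < w x)%E.
  rewrite lt_neqAle wx andbT eq_sym; apply/eqP => x_unit.
  have : (1%:E <= w (x ^+ p.-1)%R)%E.
    rewrite xpE valN -[1]addr0 val_ge_mul ?val_p // val_ge_add ?val1 //.
    by rewrite -[0]addr0 val_ge_mul.
  by rewrite (val_eq_exp _ x_unit) mulr0 lee_fin ler10.
have wxt : (0 < w (x * t)%R)%E by rewrite -[0]addr0 val_gt_mul.
have w1xt := val_one_add wxt; have u0 := val_neq0 w1xt.
have p0 := val_neq0 val_p; split.
  have p1n : (0 < p.-1)%N by rewrite -ltnS prednK ?prime_gt1 ?prime_gt0.
  rewrite (@val_exp_eq _ _ w 1 x p.-1) //; last first.
    by rewrite xpE valN (val_eq_mul val_p w1xt) addr0.
  by rewrite -subn1 natrB ?prime_gt0 // mul1r.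
have -> : p%:R / x ^+ p.-1 + 1 = (x * t) / (1 + x * t).
  rewrite xpE invrN mulrN invfM mulVKf //.
  by field_F; exact/eqP.
by rewrite -[0]addr0 val_gt_mul // (val_eq_inv w1xt) oppr0.
Qed.

Variables (M : divringClosed F) (x m : F).
Hypotheses (M_complete : complete_in w M).
Hypothesis M_unity : forall z : F, z ^+ p = 1 -> z \in M.
Hypotheses (xpM : x ^+ p \in M) (mM : m \in M) (m0 : m != 0).
Hypothesis ratio : ((p%:R / (p%:R - 1))%R%:E <= w (x ^+ p / m ^+ p - 1)%R)%E.

(** If u in M approximates t, then x is so close to m (1 + y u), relative to its
    size, that [mem_of_exp_near] applies. *)
Lemma kummer_near u t : (0 < w (t - u)%R)%E -> u \in M -> (0 <= w u)%E ->
  forall y, y \in M -> w y = ((p%:R - 1)^-1)%:E -> x = m * (1 + y * t) ->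
  x \in M.
Proof.
move=> tu uM u0 y yM wy xE.
have [r r0 ru] : exists2 r : R, 0 < r & (r%:E <= w (t - u)%R)%E.
  case: (w _) tu => [r||] //; last by exists 1; rewrite ?leey.
  by rewrite lte_fin => r0; exists r.
have wyu : (0 < w (y * u)%R)%E.
  by rewrite -[0]addr0 val_gt_mul // wy lte_fin invr_gt0.
have w1yu := val_one_add wyu; have yu0 := val_neq0 w1yu.
pose h := (p%:R - 1)^-1 + r.
have h0 : 0 < h by rewrite addr_gt0 // invr_gt0.
have hE : (p%:R - 1) * h = 1 + (p%:R - 1) * r.
  by rewrite mulrDr mulfV // gt_eqF.
have h1 : 1 < (p%:R - 1) * h by rewrite hE ltrDl mulr_gt0.
pose e := y * (t - u) / (1 + y * u).
have we : (h%:E <= w e)%E.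
  rewrite -[h]addr0 val_ge_mul ?(val_eq_inv w1yu) ?oppr0 //.
  by rewrite val_ge_mul ?wy.
have we0 : (0 <= w e)%E by apply: le_trans we; rewrite lee_fin ltW.
have m1 : m * (1 + y * u) \in M by rewrite !(rpredM, rpredD, rpred1).
have m10 : m * (1 + y * u) != 0 by rewrite mulf_neq0.
apply: (mem_of_exp_near (prime_gt1 p_prime) val_p (val_bin_prime p_prime val_p)
  h0 h1 M_complete M_unity xpM m1 m10).
have -> : x ^+ p / (m * (1 + y * u)) ^+ p = (1 + e) ^+ p.
  rewrite -expr_div_n; congr (_ ^+ _); rewrite xE /e; field_F.
  by split; exact/eqP.
have [s s0 ->] := expand we0.
have -> : 1 + p%:R * e + p%:R * e ^+ 2 * s + e ^+ p - 1 =
   e * p%:R * (1 + e * s) + e ^+ p.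
  by move: (e ^+ p) (p%:R : F) => a k; ring_F.
apply: val_ge_add.
  have es0 : (0 <= w (1 + e * s)%R)%E.
    by rewrite val_ge_add ?val1 // -[0]addr0 val_ge_mul.
  by rewrite -[h + 1]addr0 val_ge_mul // val_ge_mul ?val_p.
apply: le_trans (val_ge_exp p we); rewrite lee_fin.
by move: h1; rewrite mulrBl mul1r; lra.
Qed.

(** With 1 + P t = x / m and P = z - 1, dividing the expansion of
    (1 + P t)^p = 1 + d by P^p gives t^p - t = d / P^p up to elements of positive
    valuation, as p / P^(p-1) is close to -1. *)
Lemma val_kummer_step (z y : F) : z != 1 -> z ^+ p = 1 ->
  y \in ring_adjoin M x -> exists2 b, b \in M & w y = w b.
Proof.
move=> z1 zp yx.
have [wz wpz] := val_root_of_unity_sub1 z1 zp.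
have zM : z - 1 \in M by rewrite rpredB ?rpred1 ?M_unity.
move: wz wpz zM; set P := z - 1 => wP wpP PM.
have P0 := val_neq0 wP; have p0 := val_neq0 val_p.
pose e := x / m - 1; pose t := e / P; pose d := x ^+ p / m ^+ p - 1.
have ed : (1 + e) ^+ p = 1 + d.
  by rewrite /e /d ![1 + (_ - _)]addrC !subrK expr_div_n.
have e0 : 0 <= p%:R / (p%:R - 1) :> R by rewrite divr_ge0 ?ltW.
have we : ((p%:R - 1)^-1%R%:E <= w e)%E.
  have := val_ge_of_exp p_prime val_p ed e0 (lexx _) ratio.
  by rewrite mulrAC mulfV ?mul1r // gt_eqF.
have wt : (0 <= w t)%E.
  have wPV : ((- (p%:R - 1)^-1)%R%:E <= w P^-1%R)%E by rewrite (val_eq_inv wP).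
  by have := val_ge_mul we wPV; rewrite subrr.
have xE : x = m * (1 + P * t).
  by rewrite /t /e; field_F; split; exact/eqP.
have eP : e = P * t by rewrite /t mulrC divfK.
clearbody t; have [T TE] := ex_integer wt.
have [Ek EkP] := ex_residue_subfield w M.
have [TEk|TEk] := boolP (residue T \in Ek).
  have [U UM UT] := (EkP _).1 TEk.
  have xM : x \in M.
    apply: (@kummer_near (val U) t _ UM (integerP U) P PM wP xE).
    have : residue (T - U) == 0 by rewrite rmorphB /= UT subrr.
    by rewrite residue_eq0 rmorphB /= -TE.
  by exists y => //; apply: (ring_adjoin_min _ xM yx).
pose al := d / P ^+ p.
have alM : al \in M.
  by rewrite rpred_div ?rpredX // rpredB ?rpred1 // rpred_div // rpredX.
have wal : (0 <= w al)%E.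
  have wPp := val_eq_exp p wP.
  have wPV : ((- (p%:R / (p%:R - 1)))%R%:E <= w (P ^+ p)^-1%R)%E.
    by rewrite (val_eq_inv wPp).
  by have := val_ge_mul ratio wPV; rewrite subrr.
have [A AE] := ex_integer wal.
have as_near : (0 < w (t ^+ p - t - al)%R)%E.
  have we0 : (0 <= w e)%E by apply: le_trans we; rewrite lee_fin invr_ge0 ltW.
  have wP0 : (0 < w P)%E by rewrite wP lte_fin invr_gt0.
  have [s s0 sE] := expand we0.
  have -> : t ^+ p - t - al =
      P * (t * t * s) - (p%:R / P ^+ p.-1 + 1) * (t * (1 + e * s)).
    have PpE : P ^+ p = P * P ^+ p.-1 by rewrite -exprS prednK ?prime_gt0.
    have Q0 : P ^+ p.-1 != 0 by rewrite expf_neq0.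
    have -> : al = ((1 + e) ^+ p - 1) / P ^+ p by rewrite ed addrC addKr.
    rewrite sE eP !exprMn PpE; move: (P ^+ p.-1) (t ^+ p) (p%:R : F) Q0 => Q a k Q0.
    by field_F; split; exact/eqP.
  have ts0 : (0 <= w (t * t * s)%R)%E.
    by rewrite -[0]addr0 val_ge_mul // -[0]addr0 val_ge_mul.
  have es0 : (0 <= w (t * (1 + e * s))%R)%E.
    rewrite -[0]addr0 val_ge_mul // val_ge_add ?val1 //.
    by rewrite -[0]addr0 val_ge_mul.
  by apply: val_gt_sub; rewrite -[0]addr0 val_gt_mul.
have asE : residue T ^+ p - residue T = residue A.
  apply/eqP; rewrite -subr_eq0 -rmorphXn -!rmorphB residue_eq0.
  have -> : val (T ^+ p - T - A) = val T ^+ p - val T - val A.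
    by rewrite !rmorphB rmorphXn.
  by rewrite TE AE.
have xT : x = m * (1 + P * val T) by rewrite TE.
have yq : y \in polys_below M x p.
  have qm : 'X^p - (x ^+ p)%:P \is monic by rewrite monicXnsubC ?prime_gt0.
  have qM : 'X^p - (x ^+ p)%:P \is a polyOver M.
    by rewrite rpredB ?polyOverXn ?polyOverC.
  have qx : root ('X^p - (x ^+ p)%:P) x by rewrite rootE !hornerE subrr.
  have := ring_adjoin_polys_below qm qM qx.
  by rewrite size_XnsubC ?prime_gt0 // => <-.
have [q [qM qp ->]] := polys_belowP _ _ _ _ yq.
(* Elements of M(x) are polynomials of degree less than p in x, hence in t. *)
pose g := (m * P) *: 'X + m%:P.
have gM : g \is a polyOver M.
  by rewrite rpredD ?polyOverZ ?polyOverC ?polyOverX ?rpredM.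
have g2 : (size g <= 2)%N.
  rewrite (leq_trans (size_polyD _ _)) // geq_max (leq_trans (size_polyC_leq1 _)) //.
  by rewrite andbT (leq_trans (size_scale_leq _ _)) ?size_polyX.
have -> : q.[x] = (q \Po g).[val T].
  rewrite horner_comp xT; congr (_.[_]); rewrite hornerD hornerZ hornerX hornerC.
  by rewrite mulrDr mulr1 mulrA addrC.
have qgM : q \Po g \is a polyOver M by exact: polyOver_comp.
apply: (val_horner_free (Ek := Ek) EkP _ qgM) => Q QE Qs.
apply: (artin_schreier_free (pchar_residue p_prime _) TEk _ QE).
- by rewrite val_p lte_fin.
- by rewrite asE; apply/EkP; exists A => //=; rewrite -/(val A) AE.
- apply: leq_trans Qs _; apply: leq_trans (size_comp_poly_leq _ _) _.
  have g1 : ((size g).-1 <= 1)%N by case: (size g) g2.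
  apply: leq_ltn_trans (leq_mul (leqnn _) g1) _; rewrite muln1.
  by case: (size q) qp => //= _; exact: prime_gt0.
Qed.

End KummerStep.

(** * Residues algebraic over the prime field *)

Section FrobeniusPeriodic.
Variables (k : fieldType) (p : nat).
Hypothesis pchar_k : p \in [pchar k].

Let frob_inj n : injective (fun x : k => x ^+ (p ^ n)).
Proof.
elim: n => [|n IHn] x y; first by rewrite /= !expr1.
by rewrite /= expnSr !exprM -!(pFrobenius_autE pchar_k) => /fmorph_inj; apply: IHn.
Qed.

(** Frobenius permutes the roots of P, which are finitely many, and is injective. *)
Lemma frobenius_periodic (P : {poly k}) t :
  P != 0 -> (forall i, P`_i ^+ p = P`_i) -> root P t ->
  exists2 n, (0 < n)%N & t ^+ (p ^ n) = t.
Proof.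
move=> P0 Pfix Pt.
have root_frob x : root P x -> root P (x ^+ p).
  rewrite !rootE -!(pFrobenius_autE pchar_k) => /eqP Px.
  have {1}-> : P = map_poly (pFrobenius_aut pchar_k) P.
    by apply/polyP => i; rewrite coef_map /= pFrobenius_autE Pfix.
  by rewrite horner_map Px rmorph0.
have root_iter n : root P (t ^+ (p ^ n)).
  by elim: n => [|n IHn]; rewrite ?expr1 // expnSr exprM root_frob.
have : ~~ uniq [seq t ^+ (p ^ i) | i <- iota 0 (size P)].
  apply/negP => /(max_poly_roots P0); rewrite size_map size_iota ltnn => h.
  by have /h : all (root P) [seq t ^+ (p ^ i) | i <- iota 0 (size P)];
     first by apply/allP => _ /mapP[i _ ->].
case/(uniqPn 0) => i [j []]; rewrite size_map size_iota => ij jP.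
rewrite !(nth_map 0%N) ?size_iota ?(ltn_trans ij) // !nth_iota ?(ltn_trans ij) //.
rewrite !add0n -(subnK (ltnW ij)) expnD exprM => /frob_inj tE.
by exists (j - i)%N; rewrite ?subn_gt0.
Qed.

(** The derivative is -1. *)
Lemma separable_frobenius n : (0 < n)%N ->
  separable_poly ('X^(p ^ n) - 'X : {poly k}).
Proof.
move=> n0; rewrite unlock derivB derivXn derivX.
have -> : 'X^((p ^ n).-1) *+ (p ^ n) = 0 :> {poly k}.
  rewrite -scaler_nat natrX (pcharf0 pchar_k) expr0n gtn_eqF // scale0r //.
by rewrite sub0r -[- 1]scaleN1r coprimepZr ?oppr_eq0 ?oner_eq0 // coprimep1.
Qed.

End FrobeniusPeriodic.

(** The d + 1 coordinate vectors of 1, x, ..., x^d are linearly dependent. *)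
Lemma findim_algebraic (Q K : fieldType) (j : {rmorphism Q -> K}) d
    (b : 'I_d -> K) :
  (forall x, exists t : 'I_d -> Q, x = \sum_(i < d) j (t i) * b i) ->
  forall x, algebraicOver j x.
Proof.
move=> /choice[T TE] x; pose A := \matrix_(i < d.+1, k < d) T (x ^+ i) k.
have : kermx A != 0.
  by rewrite -mxrank_eq0 mxrank_ker subn_eq0 -ltnNge ltnS rank_leq_col.
case/rowV0Pn => u /sub_kermxP uA u0; exists (rVpoly u).
  by apply: contraNneq u0 => r0; rewrite -[u]rVpolyK r0 linear0.
have sq : (size (map_poly j (rVpoly u)) <= d.+1)%N.
  by rewrite size_map_poly size_poly.
apply/eqP; rewrite (horner_coef_wide _ sq).
transitivity (\sum_(i < d.+1) \sum_(k < d) j (u 0 i) * (j (T (x ^+ i) k) * b k)).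
  apply: eq_bigr => i _.
  by rewrite coef_map coef_rVpoly_ord [x ^+ i in LHS]TE mulr_sumr.
rewrite exchange_big big1 //= => k _.
have /matrixP/(_ 0 k) := uA; rewrite !mxE => /(congr1 j); rewrite rmorph0 => uk.
transitivity (j (\sum_i u 0 i * A i k) * b k); last by rewrite uk mul0r.
rewrite rmorph_sum mulr_suml; apply: eq_bigr => i _.
by rewrite mxE rmorphM mulrA.
Qed.

Section ResiduePeriodic.
Variables (R : realType) (p : nat).

(** Fermat's little theorem, for the numerator and the denominator; the latter is
    prime to p, as the two are coprime. *)
Lemma frobenius_rat (F : fieldType) (w : valuation R F) (X : integers w) (r : rat) :
  p \in [pchar residue_field w] -> val X = ratr r -> (0 <= padic_val R p r)%E ->
  residue X ^+ p = residue X.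
Proof.
move=> pchar_k Xr r0; have p_prime := pcharf_prime pchar_k.
have frob_int (m : int) : residue (m%:~R : integers w) ^+ p = residue m%:~R.
  by rewrite -(pFrobenius_autE pchar_k) !rmorph_int.
have [r_eq0|rN0] := eqVneq r 0.
  have -> : X = 0 by apply: val_inj; rewrite Xr r_eq0 /ratr mul0r.
  by rewrite (rmorph0 (@residue R F w)) expr0n gtn_eqF // prime_gt0.
have den0 : residue ((denq r)%:~R : integers w) != 0.
  have -> : denq r = `|denq r|%N :> int by rewrite absz_denq.
  rewrite rmorph_int /= -pmulrn -(dvdn_pcharf pchar_k); apply/negP => pd.
  move: r0; rewrite /padic_val (negPf rN0) lee_fin subr_ge0 ler_nat => le_log.
  have : (0 < logn p `|numq r|)%N.
    by apply: leq_trans le_log; rewrite logn_gt0 mem_primes p_prime pd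
      absz_gt0 denq_neq0.
  rewrite logn_gt0 mem_primes => /and3P[_ _ pn].
  have := coprime_num_den r; rewrite /coprime => /eqP g1.
  have := dvdn_gcd p `|numq r| `|denq r|.
  by rewrite g1 pn pd dvdn1 (gtn_eqF (prime_gt1 p_prime)).
have XE : X * (denq r)%:~R = (numq r)%:~R.
  apply: val_inj; rewrite [RHS]rmorph_int.
  have -> : val (X * (denq r)%:~R) = val X * (denq r)%:~R.
    by rewrite rmorphM rmorph_int.
  rewrite Xr /ratr divfK //; apply: contraNneq den0 => d0.
  by rewrite residue_eq0 rmorph_int d0 val0 ltry.
apply: (mulIf den0); rewrite -[in LHS](frob_int (denq r)) -exprMn -!rmorphM XE.
exact: frob_int.
Qed.

(** An integer of Q_p has the same residue as a rational number close to it. *)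
Lemma frobenius_Qp (Q F : fieldType) (vQ : valuation R Q) (w : valuation R F)
    (j : {rmorphism Q -> F}) (X : integers w) (y : Q) :
  p \in [pchar residue_field w] -> is_Qp p vQ -> (forall x, w (j x) = vQ x) ->
  val X = j y -> residue X ^+ p = residue X.
Proof.
move=> pchar_k [_ vQ_rat _ dense] w_j XE; have [r yr] := dense y 0.
have y0 : (0 <= vQ y)%E by rewrite -w_j -XE; exact: integerP.
have r0 : (0 <= vQ (ratr r))%E.
  by rewrite -[ratr r](subKr y) val_ge_sub // ltW.
have [Y YE] : exists Y : integers w, val Y = ratr r.
  by apply: ex_integer; rewrite -(fmorph_rat j) w_j.
have -> : residue X = residue Y.
  apply/eqP; rewrite -subr_eq0 -rmorphB residue_eq0.
  have -> : val (X - Y) = val X - val Y by rewrite rmorphB.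
  by rewrite XE YE -(fmorph_rat j) -rmorphB w_j.
by apply: frobenius_rat pchar_k YE _; rewrite -vQ_rat.
Qed.

(** Reduce a suitably scaled polynomial relation over Q_p. *)
Lemma residue_periodic (Q F : fieldType) (vQ : valuation R Q) (w : valuation R F)
    (j : {rmorphism Q -> F}) (t : residue_field w) :
  p \in [pchar residue_field w] -> is_Qp p vQ -> (forall x, w (j x) = vQ x) ->
  (forall z, algebraicOver j z) -> exists2 n, (0 < n)%N & t ^+ (p ^ n) = t.
Proof.
move=> pchar_k QpQ w_j alg; have [T TE] : exists T : integers w, residue T = t.
  by exists (repr t); rewrite /residue reprK.
have [q q0 qT] := alg (val T); have [i qi0 q'0] := ex_min_coef vQ q0.
pose q' := (q`_i)^-1 *: q.
have [P PE] : exists P : {poly integers w}, map_poly val P = map_poly j q'.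
  by apply: lift_poly => n; rewrite coef_map w_j.
have coefP n : val P`_n = j q'`_n by rewrite -[RHS]coef_map -PE coef_map.
apply: (@frobenius_periodic _ _ pchar_k (map_poly (@residue R F w) P)).
- apply/eqP => /polyP/(_ i); rewrite coef_map coef0.
  have -> : P`_i = 1 by apply: val_inj; rewrite coefP coefZ mulVf // !rmorph1.
  by rewrite /= => /eqP; rewrite (rmorph1 (@residue R F w)) oner_eq0.
- by move=> n; rewrite coef_map; apply: frobenius_Qp pchar_k QpQ w_j (coefP n).
- rewrite -TE rootE horner_map; apply/eqP.
  have -> : P.[T] = 0.
    apply: val_inj; rewrite -horner_map PE linearZ hornerZ (eqP qT) mulr0 //.
  exact: (rmorph0 (@residue R F w)).
Qed.

End ResiduePeriodic.

(** * The fields generated by preimages *)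

Section PreimageFields.
Variables (R : realType) (K : fieldType) (v : valuation R K).
Variables (Kbar : closedFieldType) (iota : {rmorphism K -> Kbar}).
Variables (w : valuation R Kbar) (l : nat) (c a : K).
Hypothesis v_complete : complete_valuation v.
Hypothesis Kbar_algebraic : forall z : Kbar, algebraicOver iota z.
Hypothesis w_extends_v : forall x : K, w (iota x) = v x.
Hypothesis l_ge2 : (2 <= l)%N.

Let f (z : Kbar) : Kbar := z ^+ l - iota c.
Let pre (n : nat) (z : Kbar) : Prop := iter n f z = iota a.

Lemma preimagesE n :
  preimages iota ('X^l - c%:P) a n = [set z | iter n f z = iota a].
Proof.
have hornerf m z : (map_poly iota (iter_poly ('X^l - c%:P) m)).[z] = iter m f z.
  elim: m => [|m IHm]; first by rewrite /= map_polyX hornerX.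
  rewrite [iter_poly _ _]/= map_comp_poly horner_comp IHm rmorphB /= map_polyXn.
  by rewrite map_polyC hornerD hornerN hornerXn hornerC.
by apply/seteqP; split=> z; rewrite /preimages /= hornerf.
Qed.

Lemma iter_preimage n z : exists y, iter n f y = z.
Proof.
elim: n z => [|n IHn] z; first by exists z.
have [y <-] := IHn z.
have /closed_rootP[x] : size ('X^l - (y + iota c)%:P) != 1%N.
  by rewrite size_XnsubC ?gtn_eqF // ltnW.
rewrite rootE !hornerE subr_eq0 => /eqP xE; exists x.
by rewrite iterSr /f xE addrK.
Qed.

Lemma preimage_seq n : exists s : seq Kbar, forall z, (z \in s) <-> pre n z.
Proof.
elim: n => [|n [s sP]].
  by exists [:: iota a] => z; rewrite /pre /= inE; split=> /eqP.
have /choice[rts rtsP] : forall y, exists r : seq Kbar, forall z, (z \in r) = (f z == y).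
  move=> y; pose P := 'X^l - (y + iota c)%:P.
  have P0 : P != 0 by rewrite -size_poly_gt0 size_XnsubC ?(ltnW l_ge2).
  have lc0 : lead_coef P != 0 by rewrite lead_coef_eq0.
  have [r PE] := closed_field_poly_normal P; exists r => z.
  rewrite -root_prod_XsubC -(rootZ _ _ lc0) -PE.
  by rewrite rootE !hornerE subr_eq0 /f subr_eq.
exists (flatten [seq rts y | y <- s]) => z; rewrite /pre iterSr; split.
  by move=> /flatten_mapP[y /sP ys]; rewrite rtsP => /eqP->.
by move=> /sP fz; apply/flatten_mapP; exists (f z) => //; rewrite rtsP.
Qed.

Lemma base_field : exists M : divringClosed Kbar,
  complete_in w M /\ forall z, (z \in M) <-> exists x, z = iota x.
Proof.
pose E (z : Kbar) := `[< exists x, z = iota x >].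
have Ed : GRing.divring_closed (E : {pred Kbar}).
  split.
  - by apply/asboolP; exists 1; rewrite rmorph1.
  - move=> _ _ /asboolP[x ->] /asboolP[y ->]; apply/asboolP.
    by exists (x - y); rewrite rmorphB.
  - move=> _ _ /asboolP[x ->] /asboolP[y ->]; apply/asboolP.
    by exists (x / y); rewrite fmorph_div.
pose D := GRing.isDivringClosed.Build _ _ Ed.
exists (HB.pack (E : {pred Kbar}) D : divringClosed Kbar); split=> [u uE uc|z].
  have /choice[t tE] : forall n, exists x, u n = iota x.
    by move=> n; apply/asboolP; exact: uE.
  have [B|x tx] := v_complete (u := t).
    have [N NP] := uc B; exists N => m n mN nN.
    by rewrite -w_extends_v rmorphB -!tE NP.
  exists (iota x); first by apply/asboolP; exists x.
  move=> B; have [N NP] := tx B; exists N => n nN.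
  by rewrite tE -rmorphB w_extends_v NP.
by split=> [/asboolP|?] //; apply/asboolP.
Qed.

(** The intersection defining [adjoin] ranges over sets that are closed under
    field operations; this is its universal property among subfields in the
    sense of [divringClosed], to which the closure lemmas apply. *)
Lemma adjoinE (S : set Kbar) (L : divringClosed Kbar) :
  (forall x, iota x \in L) -> (forall z, S z -> z \in L) ->
  (forall A : divringClosed Kbar, (forall x, iota x \in A) ->
     (forall z, S z -> z \in A) -> {subset L <= A}) ->
  adjoin iota S = [set` L].
Proof.
move=> iotaL SL Lmin; apply/seteqP; split=> z.
  move=> /(_ [set` L]); apply; split; last first.
    by move=> y [[x _ <-]|/SL//]; exact: iotaL.
  by split=> [|x y|x y]; rewrite !in_setE /= ?rpred1 //;
     [exact: rpredB|exact: rpred_div].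
move=> zL A [Ad AS].
pose D := GRing.isDivringClosed.Build _ _ Ad.
have := Lmin (HB.pack (mem A : {pred Kbar}) D : divringClosed Kbar).
move=> /(_ _ _ z zL) h; rewrite -in_setE; apply: h => [x|y yS].
  by rewrite in_setE; apply: AS; left; exists x.
by rewrite in_setE; apply: AS; right.
Qed.

Lemma preimage_field_struct n : exists L : divringClosed Kbar,
  [/\ complete_in w L, forall x, iota x \in L, forall z, pre n z -> z \in L,
      forall A : divringClosed Kbar, (forall x, iota x \in A) ->
        (forall z, pre n z -> z \in A) -> {subset L <= A} &
      preimage_field iota ('X^l - c%:P) a n = [set` L]].
Proof.
have [M [cM ME]] := base_field; have [s sP] := preimage_seq n.
have iotaM x : iota x \in M by apply/ME; exists x.
have [L [[ML sL Lmin] cL _]] := ex_adjunction_seq Kbar_algebraic (s := s)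
  (P := fun=> True) iotaM cM I (fun _ _ _ _ _ _ _ _ => I).
have iotaL x : iota x \in L by exact/ML/iotaM.
have preL z : pre n z -> z \in L by move=> /sP; exact: sL.
have min (A : divringClosed Kbar) : (forall x, iota x \in A) ->
    (forall z, pre n z -> z \in A) -> {subset L <= A}.
  move=> iotaA preA; apply: Lmin => [z /ME[x ->]|z /sP /preA] //.
exists L; split=> //; rewrite /preimage_field preimagesE.
exact: adjoinE.
Qed.

Lemma preimage_below (L : divringClosed Kbar) m n : (forall x, iota x \in L) ->
  (forall z, pre n z -> z \in L) -> (m <= n)%N -> forall z, pre m z -> z \in L.
Proof.
move=> iotaL preL mn z zm; have [y yz] := iter_preimage (n - m) z.
have yL : y \in L.
  by apply: preL; rewrite /pre -(subnKC mn) iterD yz.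
rewrite -yz; elim: (n - m)%N => [|k IHk] //=.
by rewrite rpredB ?rpredX.
Qed.

(** For y in f^(-1)(a), the products z y with z^l = 1 are in f^(-1)(a) as well, and
    y is nonzero because y^l = a + c. *)
Lemma unity_in_preimages (L : divringClosed Kbar) z : (forall z, pre 1 z -> z \in L) ->
  a + c != 0 -> z ^+ l = 1 -> z \in L.
Proof.
move=> preL ac zl; have [y y1] := iter_preimage 1 (iota a).
have y0 : y != 0.
  apply: contraNneq ac => y0; move: y1; rewrite y0 /= /f expr0n gtn_eqF ?(ltnW l_ge2) //.
  by rewrite sub0r -rmorphN => /fmorph_inj <-; rewrite addNr.
rewrite -(mulfK y0 z) rpred_div ?preL //.
by move: y1; rewrite /pre /= /f exprMn zl mul1r.
Qed.

(** Preimages of level at most n are images of those of level n.  At level m + 1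
    with m >= n, z^l = f z + c is in L by induction, and (z / f z)^l is close
    enough to 1 for [mem_of_exp_near]. *)
Lemma preimages_in (s : R) (L : divringClosed Kbar) n :
  w l%:R = s%:E -> (forall i, (0 < i < l)%N -> (s%:E <= w 'C(l, i)%:R%R)%E) ->
  complete_in w L -> (forall x, iota x \in L) -> (forall z, pre n z -> z \in L) ->
  (forall z : Kbar, z ^+ l = 1 -> z \in L) ->
  (forall m z, (n <= m)%N -> pre m.+1 z -> f z != 0 /\ exists2 h : R,
    0 < h /\ s < (l%:R - 1) * h &
    ((h + s)%R%:E <= w (z ^+ l / f z ^+ l - 1)%R)%E) ->
  forall m z, pre m z -> z \in L.
Proof.
move=> wl wbin cL iotaL preL muL ratio; elim=> [|m IHm] z zm.
  exact: (preimage_below iotaL preL (leq0n n) zm).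
have [mn|nm] := leqP m.+1 n; first exact: (preimage_below iotaL preL mn zm).
have fzL : f z \in L by apply: IHm; move: zm; rewrite /pre iterSr.
have [fz0 [h [h0 h1] hz]] := ratio m z nm zm.
apply: (mem_of_exp_near l_ge2 wl wbin h0 h1 cL muL _ fzL fz0 hz).
by rewrite -(subrK (iota c) (z ^+ l)) rpredD.
Qed.

(** Only the inclusion of K_m in K_n matters, and by minimality of K_m it is
    enough to check generators. *)
Lemma preimage_field_stable n : (1 <= n)%N ->
  (forall L : divringClosed Kbar, complete_in w L -> (forall x, iota x \in L) ->
     (forall z, pre n z -> z \in L) -> forall m z, pre m z -> z \in L) ->
  preimage_field_infty iota ('X^l - c%:P) a = preimage_field iota ('X^l - c%:P) a n.
Proof.
move=> n1 stable; have [L [cL iotaL preL _ LE]] := preimage_field_struct n.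
apply/seteqP; split=> z; last by exists n.
move=> [m _]; have [L' [_ _ _ L'min ->]] := preimage_field_struct m.
rewrite LE; apply: L'min => // y; exact: stable.
Qed.

End PreimageFields.

(** * The two cases of the theorem *)

Section NuIdentity.
Variable F : fieldType.
Add Field F_field10 : (field_theory_F F).

Lemma nu_cancel (x y : F) : x - 1 != 0 -> y != 0 -> y - 1 != 0 ->
  - (x * y / ((y - 1) * (x - 1))) * (1 - y^-1) = - (x / (x - 1)).
Proof. by move=> x1 y0 y1; field_F; do !split; apply/eqP. Qed.

End NuIdentity.

(** This is where the thresholds nu_n come from: - nu_n (1 - p^(-n)) is
    p / (p - 1), the valuation from which 1 + d starts to be a p-th power up to
    an unramified extension. *)
Lemma nu_mulE (R : realType) (p n : nat) : (1 < p)%N -> (0 < n)%N ->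
  nu R p n * (1 - p%:R^-1 ^+ n) = - (p%:R / (p%:R - 1)).
Proof.
move=> p1 n0; have pR : 1 < p%:R :> R by rewrite ltr1n.
have pn : 1 < p%:R ^+ n :> R by rewrite exprn_egt1 // gtn_eqF.
rewrite /nu exprVn exprS nu_cancel ?subr_eq0 ?gt_eqF //.
exact: lt_trans ltr01 pn.
Qed.

Section Unramified.
Variables (R : realType) (K F : fieldType) (w : valuation R F).
Variables (iota : {rmorphism K -> F}) (p : nat).
Hypothesis F_algebraic : forall z : F, algebraicOver iota z.
Hypotheses (p_prime : prime p) (val_p : w p%:R = 1%E).

(** The condition on x remains true when M grows, so the elements of s can be
    adjoined one by one. *)
Lemma kummer_adjunction_seq (M : divringClosed F) (s : seq F) (z : F) :
  (forall x, iota x \in M) -> complete_in w M ->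
  (forall u : F, u ^+ p = 1 -> u \in M) -> z != 1 -> z ^+ p = 1 ->
  (forall x, x \in s -> exists2 m, m \in M /\ m != 0 &
     x ^+ p \in M /\ ((p%:R / (p%:R - 1))%R%:E <= w (x ^+ p / m ^+ p - 1)%R)%E) ->
  exists M' : divringClosed F,
    adjunction M [set` s] M' /\ forall y, y \in M' -> exists2 b, b \in M & w y = w b.
Proof.
move=> iotaM cM muM z1 zp near.
have [||M' [MM' _ val_M']] := ex_adjunction_seq (s := s) F_algebraic
  (P := fun M' => forall y, y \in M' -> exists2 b, b \in M & w y = w b) iotaM cM.
- by move=> y yM; exists y.
- move=> M1 M2 x xs MM1 cM1 val_M1 M2E y; rewrite M2E.
  have [m [mM m0] [xpM ratio]] := near x xs.
  move=> /(val_kummer_step p_prime val_p cM1 (fun u up => MM1 _ (muM u up))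
    (MM1 _ xpM) (MM1 _ mM) m0 ratio z1 zp)[b /val_M1[b' b'M bE] yE].
  by exists b' => //; rewrite yE.
- by exists M'.
Qed.

End Unramified.

Section Extension.
Variables (R : realType) (Q K F : fieldType) (j : {rmorphism Q -> K}).
Variable iota : {rmorphism K -> F}.

Lemma algebraic_tower : (forall x, algebraicOver j x) ->
  (forall z, algebraicOver iota z) ->
  forall z, algebraicOver (iota \o j : {rmorphism Q -> F}) z.
Proof.
move=> algK algF z; apply/integral_algebraic.
have /integral_algebraic[q qm qz] := algF z.
apply: integral_root_monic qz _; first by rewrite monic_map.
apply/integral_poly => i; rewrite coef_map; apply: integral_rmorph.
exact/integral_algebraic.
Qed.

End Extension.

Section Stabilization.
Variables (R : realType) (K : fieldType) (v : valuation R K).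
Variables (Kbar : closedFieldType) (iota : {rmorphism K -> Kbar}).
Variables (w : valuation R Kbar) (l : nat) (c a : K) (C : R).
Hypothesis v_complete : complete_valuation v.
Hypothesis Kbar_algebraic : forall z : Kbar, algebraicOver iota z.
Hypothesis w_extends_v : forall x : K, w (iota x) = v x.
Hypothesis l_ge2 : (2 <= l)%N.
Hypotheses (C_gt0 : 0 < C) (val_c : v c = (- C)%:E).
Hypothesis val_a : ((- (C / l%:R))%R%:E <= v a)%E.

Let f (z : Kbar) : Kbar := z ^+ l - iota c.

Let C_l : C / l%:R < C.
Proof.
by rewrite ltr_pdivrMr ?ltr0n ?(ltnW l_ge2) // ltr_pMr // ltr1n.
Qed.

Let w_c : w (iota c) = (- C)%:E.
Proof. by rewrite w_extends_v. Qed.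

Let w_a : ((- (C / l%:R))%R%:E <= w (iota a))%E.
Proof. by rewrite w_extends_v. Qed.

Lemma a_add_c_neq0 : a + c != 0.
Proof.
apply/eqP => ac0; have aE : a = - c by rewrite -(addrK c a) ac0 sub0r.
by move: val_a; rewrite aE valN val_c lee_fin lerN2 leNgt C_l.
Qed.

Lemma unity_in_field (L : divringClosed Kbar) n : (1 <= n)%N ->
  (forall x, iota x \in L) -> (forall z, iter n f z = iota a -> z \in L) ->
  forall z : Kbar, z ^+ l = 1 -> z \in L.
Proof.
move=> n1 iotaL preL z; apply: unity_in_preimages a_add_c_neq0 => // y.
exact: (preimage_below l_ge2 iotaL preL n1).
Qed.

Lemma preimage_neq0 m z : iter m.+1 f z = iota a -> z != 0.
Proof. by move/(val_preimage l_ge2 C_gt0 w_c w_a)/val_neq0. Qed.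

Lemma tame_stable : w l%:R = 0%E ->
  preimage_field_infty iota ('X^l - c%:P) a = preimage_field iota ('X^l - c%:P) a 1.
Proof.
move=> wl; apply: (preimage_field_stable v_complete Kbar_algebraic w_extends_v) => //.
move=> L cL iotaL preL; apply: (preimages_in l_ge2 wl _ cL iotaL preL).
- by move=> i _; exact: val_nat.
- exact: unity_in_field preL.
- case=> // m z _ zm; split; first by apply: (@preimage_neq0 m); move: zm; rewrite iterSr.
  have h0 : 0 < C - C / l%:R by rewrite subr_gt0.
  exists (C - C / l%:R).
    by split=> //; rewrite mulr_gt0 // subr_gt0 ltr1n.
  by rewrite addr0 (val_ratio_preimage_ge l_ge2 C_gt0 w_c w_a zm).
Qed.

Hypotheses (l_prime : prime l) (val_l : w l%:R = 1%E).
Let e : R := l%:R / (l%:R - 1).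

Let l1_gt0 : 0 < l%:R - 1 :> R.
Proof. by rewrite subr_gt0 ltr1n. Qed.

(** The quantity C (1 - l^(-m)) is the part of [wild_bound] that depends on m. *)
Lemma wild_stable n : (1 <= n)%N -> e < C ->
  (forall m, (n <= m)%N -> e < C * (1 - l%:R^-1 ^+ m)) ->
  preimage_field_infty iota ('X^l - c%:P) a = preimage_field iota ('X^l - c%:P) a n.
Proof.
move=> n1 eC large.
apply: (preimage_field_stable v_complete Kbar_algebraic w_extends_v) => //.
move=> L cL iotaL preL.
apply: (preimages_in l_ge2 val_l (val_bin_prime l_prime val_l) cL iotaL preL).
- exact: unity_in_field preL.
- case=> [|m] z; first by case: (n) n1.
  move=> nm zm; split; first by apply: (@preimage_neq0 m); move: zm; rewrite iterSr.
  have eB : e < wild_bound l C m.+1.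
    by rewrite lt_min large //= (wild_cap_gt l_prime eC).
  have eE : e = 1 + (l%:R - 1)^-1.
    by rewrite /e -{1}(subrK 1 l%:R) mulrDl mulfV ?gt_eqF // mul1r.
  (* The valuation of l itself is 1, which leaves this much for d / l. *)
  exists (wild_bound l C m.+1 - 1).
    have h : (l%:R - 1)^-1 < wild_bound l C m.+1 - 1.
      by rewrite ltrBrDl -eE.
    split; first by apply: lt_trans h; rewrite invr_gt0.
    by move: h; rewrite -[_^-1]mul1r ltr_pdivrMr // mulrC.
  by rewrite subrK (val_ratio_wild l_prime val_l w_c w_a (ltW eC) zm).
Qed.

(** The field generated by level n + 1 over K_n is a compositum of the extensions
    treated in [val_kummer_step], with m = f x. *)
Lemma wild_unramified n : (1 <= n)%N -> e < C -> C * (1 - l%:R^-1 ^+ n) = e ->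
  finite_extension_of_Qp l v ->
  unramified w (preimage_field iota ('X^l - c%:P) a n)
               (preimage_field iota ('X^l - c%:P) a n.+1).
Proof.
move=> n1 eC Ce [Q [vQ [j [QpQ v_j [d [b bP]]]]]].
have pchar_k : l \in [pchar residue_field w].
  by apply: pchar_residue; rewrite // val_l lte_fin.
have [M [cM iotaM preM Mmin ->]] :=
  preimage_field_struct c a v_complete Kbar_algebraic w_extends_v l_ge2 n.
have [L [_ iotaL preL Lmin ->]] :=
  preimage_field_struct c a v_complete Kbar_algebraic w_extends_v l_ge2 n.+1.
have [s sP] := preimage_seq iota c a l_ge2 n.+1.
have muM := unity_in_field n1 iotaM preM.
have [z z1 zl] := ex_root_of_unity l_prime (val_neq0 val_l).
have ML : {subset M <= L}.
  by apply: Mmin => // y; apply: (preimage_below l_ge2 iotaL preL (leqnSn n)).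
have [|M' [[MM' sM' M'min] valM']] := kummer_adjunction_seq Kbar_algebraic l_prime
    val_l (s := s) iotaM cM muM z1 zl.
  move=> x /sP xn; have fxn : iter n f (f x) = iota a by move: xn; rewrite iterSr.
  have fxM := preM _ fxn.
  case: n n1 Ce M cM iotaM preM Mmin L iotaL preL Lmin s sP muM ML xn fxn fxM => // n _ Ce.
  move=> M cM iotaM preM Mmin L iotaL preL Lmin s sP muM ML xn fxn fxM.
  exists (f x); first by split=> //; exact: preimage_neq0 fxn.
  split; first by rewrite -(subrK (iota c) (x ^+ l)) rpredD.
  apply: le_trans (val_ratio_wild l_prime val_l w_c w_a (ltW eC) xn).
  by rewrite lee_fin le_min Ce lexx /= ltW // (wild_cap_gt l_prime eC).
have M'L : {subset M' <= L} by apply: M'min => // x /sP; exact: preL.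
have LM' : {subset L <= M'}.
  by apply: Lmin => [x|x /sP /sM'//]; exact/MM'/iotaM.
split.
- by move=> x /ML.
- apply/seteqP; split=> _ [y yL <-].
    by have [b' b'M ->] := valM' y (LM' _ yL); exists b'.
  by exists y => //; exact: ML.
move=> t _; have [k k0 tk] : exists2 k, (0 < k)%N & t ^+ (l ^ k) = t.
  apply: (residue_periodic (j := iota \o j) t pchar_k QpQ).
    by move=> x /=; rewrite w_extends_v v_j.
  by apply: algebraic_tower => //; exact: findim_algebraic bP.
exists ('X^(l ^ k) - 'X); split.
- have [E EP] := ex_residue_subfield w M => i; apply/EP.
  have : 'X^(l ^ k) - 'X \is a polyOver E by rewrite rpredB ?polyOverXn ?polyOverX.
  by move=> /polyOverP.
- exact: separable_frobenius.
- by rewrite rootE !hornerE tk subrr.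
Qed.

End Stabilization.

Theorem theorem4p3 (R : realType) (K : fieldType) (v : valuation R K) (p : nat)
  (v_discrete : discrete_valuation v) (v_complete : complete_valuation v)
  (residue_char : has_characteristic (residue_field v) p)
  (Kbar : closedFieldType) (iota : {rmorphism K -> Kbar})
  (Kbar_algebraic : forall z : Kbar, algebraicOver iota z)
  (w : valuation R Kbar) (w_extends_v : forall x : K, w (iota x) = v x)
  (l : nat) (l_ge2 : (2 <= l)%N) (c a : K) (c_neq0 : c != 0)
  (a_distinct : forall n : nat, distinct_preimages iota ('X^l - c%:P) a n)
  (va_ge : (v c * (l%:R^-1)%:E <= v a)%E) :
  let K_ := preimage_field iota ('X^l - c%:P) a in
  let K_infty := preimage_field_infty iota ('X^l - c%:P) a in
  (* tame case *)
  (~~ (p %| l)%N -> (v c < 0)%E -> K_infty = K_ 1%N)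
  /\
  (* wild case *)
  (l = p -> finite_extension_of_Qp p v -> v p%:R = 1%E ->
   forall n : nat, (1 <= n)%N ->
     ((v c < (nu R p n)%:E)%E -> K_infty = K_ n) /\
     (v c = (nu R p n)%:E ->
        K_infty = K_ n.+1 /\ unramified w (K_ n) (K_ n.+1))).
Proof.
move=> K_ K_infty; have [r vc] := val_real v c_neq0.
pose C := - r; have {}vc : v c = (- C)%:E by rewrite vc opprK.
have va : ((- (C / l%:R))%R%:E <= v a)%E.
  by move: va_ge; rewrite vc -EFinM mulNr.
split=> [pl|lp Kfin vp n n1].
  rewrite vc lte_fin oppr_lt0 => C0.
  apply: (tame_stable v_complete Kbar_algebraic w_extends_v l_ge2 C0 vc va).
  rewrite -(rmorph_nat iota) w_extends_v.
  have l0 : residue (l%:R : integers v) != 0.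
    rewrite rmorph_nat; case: residue_char => [pk|[p0 /pcharf0P->]].
      by rewrite -(dvdn_pcharf pk).
    by rewrite gtn_eqF // ltnW.
  apply/eqP; rewrite eq_le val_nat andbT leNgt; move: l0; rewrite residue_eq0.
  by rewrite rmorph_nat.
subst p; have [_ [_ [_ [[l_prime _ _ _] _ _]]]] := Kfin.
have wl : w l%:R = 1%E by rewrite -(rmorph_nat iota) w_extends_v vp.
have l1 : 1 < l%:R :> R by rewrite ltr1n.
have q0 : 0 < l%:R^-1 :> R by rewrite invr_gt0 (lt_trans ltr01).
have q1 : l%:R^-1 < 1 :> R by rewrite invf_lt1 // (lt_trans ltr01).
pose e : R := l%:R / (l%:R - 1).
have e0 : 0 < e by rewrite divr_gt0 ?subr_gt0 // (lt_trans ltr01).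
have gap k : 0 < (1 : R) - l%:R^-1 ^+ k.+1.
  by rewrite subr_gt0 exprn_ilt1 // ltW.
have gapn : 0 < (1 : R) - l%:R^-1 ^+ n by case: (n) n1 => // k _.
have nuE := nu_mulE R l_ge2 n1.
have C_gt : e <= C * (1 - l%:R^-1 ^+ n) -> e < C.
  move=> eC; have C0 : 0 < C by rewrite -(pmulr_lgt0 _ gapn) (lt_le_trans e0).
  by apply: le_lt_trans eC _; rewrite gtr_pMr // ltrBlDr ltrDl exprn_gt0.
split=> [|vnu].
  rewrite vc lte_fin -(ltr_pM2r gapn) nuE mulNr ltrN2 => eC.
  have eC' := C_gt (ltW eC).
  apply: (wild_stable v_complete Kbar_algebraic w_extends_v l_ge2 _ vc va) => //.
    exact: lt_trans eC'.
  move=> m nm; apply: lt_le_trans eC _; rewrite ler_pM2l ?(lt_trans e0) //.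
  by rewrite lerD2l lerN2 ler_wiXn2l // ltW.
have Ce : C * (1 - l%:R^-1 ^+ n) = e.
  apply: oppr_inj; rewrite -nuE -mulNr; congr (_ * _).
  by move: vnu; rewrite vc => -[].
have eC : e < C by apply: C_gt; rewrite Ce.
have C0 : 0 < C := lt_trans e0 eC.
split; last first.
  exact: (wild_unramified v_complete Kbar_algebraic w_extends_v l_ge2 C0 vc va).
apply: (wild_stable v_complete Kbar_algebraic w_extends_v l_ge2 C0 vc va) => //.
move=> m nm; rewrite -/e -Ce ltr_pM2l // ltrD2l ltrN2.
by rewrite ltr_iXn2l.
Qed.
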